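(* Let $\Omega$ be any infinite set, let $\mathcal{F}$ be a non-principal ultrafilter on $\Omega$, and let $\kappa$ ($\geq\aleph_0$) be the least cardinality of a subset of $\Omega$ in $\mathcal{F}$. Then the maximal subsemigroups of $\Omega^\Omega$ containing the stabiliser $\operatorname{Sym}(\Omega)_{\{\mathcal{F}\}}$ but not containing $\operatorname{Sym}(\Omega)$ are precisely the sets $$U_1(\mathcal{F},\mu)=\{f\in\Omega^\Omega : d(f)\geq\mu \text{ or } \Omega f\notin\mathcal{F} \text{ or } (c(f)<\mu \text{ and } (\forall\Sigma\notin\mathcal{F})(\Sigma f\notin\mathcal{F}))\}\cup\mathfrak{F},$$ $$U_2(\mathcal{F},\mu)=\{f\in\Omega^\Omega : c(f)\geq\mu \text{ or } (\forall\Sigma\in\mathcal{F})(c(f|_\Sigma)>0) \text{ or } (d(f)<\mu \text{ and } (\forall\Sigma\in\mathcal{F})(\Sigma f\in\mathcal{F}))\}\cup\mathfrak{F},$$ where $\mu$ is an infinite cardinal such that $\kappa<\mu\leq|\Omega|^+$.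
   Context: $\Omega^\Omega$ is the semigroup of all mappings from $\Omega$ to itself; mappings are written to the right of their arguments and composed from left to right. $\operatorname{Sym}(\Omega)$ is the symmetric group on $\Omega$. A subsemigroup $T$ of a semigroup $S$ is a maximal subsemigroup if $T\neq S$ and the subsemigroup $\langle T,s\rangle$ generated by $T$ and $s$ equals $S$ for all $s\in S\setminus T$. For $\Sigma\subseteq\Omega$ and a mapping $f:\Sigma\to\Omega$, a transversal of $f$ is a set $T\subseteq\Sigma$ such that $f|_T$ is injective and $Tf=\Sigma f$; put $c(f)=|\Sigma\setminus T|$ for any transversal $T$ of $f$, and $d(f)=|\Omega\setminus\Sigma f|$, where $\Sigma f=\{\alpha f:\alpha\in\Sigma\}$. In particular $c(f|_\Sigma)>0$ means that $f$ is not injective on $\Sigma$. $\mathfrak{F}=\{f\in\Omega^\Omega:|\Omega f|<|\Omega|\}$. The stabiliser of $\mathcal{F}$ is $\operatorname{Sym}(\Omega)_{\{\mathcal{F}\}}=\{f\in\operatorname{Sym}(\Omega):(\forall\Sigma\subseteq\Omega)(\Sigma\in\mathcal{F}\leftrightarrow\Sigma f\in\mathcal{F})\}$. Quantifiers over $\Sigma$ in the definitions range over subsets of $\Omega$. $|\Omega|^+$ is the successor cardinal of $|\Omega|$. *)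

(* Defs.v *)
From mathcomp Require Import all_boot.
From mathcomp Require Import boolp classical_sets functions cardinality filter.

Set Implicit Arguments.
Unset Strict Implicit.
Unset Printing Implicit Defensive.

Local Open Scope classical_set_scope.
Local Open Scope card_scope.

(* A cardinal is represented by an arbitrary set (in an arbitrary type) having
   that cardinality, and is only ever compared through [#<=] and [#=]. *)

Definition card_lt T U (A : set T) (B : set U) : Prop := A #<= B /\ ~ (A #= B).

Notation "A '#<' B" := (card_lt A B) (at level 79) : card_scope.

Definition is_succ_card (I J : Type) (A : set I) (S : set J) : Prop :=
  A #< S /\ forall (K : Type) (C : set K), A #< C -> S #<= C.

Definition le_succ_card (I J : Type) (M : set I) (A : set J) : Prop :=
  exists (K : Type) (S : set K), is_succ_card A S /\ M #<= S.

Definition least_card_member (Omega : Type) (F : set_system Omega)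
    (K : set Omega) : Prop :=
  F K /\ forall S : set Omega, F S -> K #<= S.

Section Transformations.
Variable Omega : Type.
Implicit Types (f g : Omega -> Omega) (A : set Omega)
  (T : set (Omega -> Omega)) (F : set_system Omega).

(* Mappings compose from left to right: the product of [f] and [g] applies
   [f] first. *)
Definition subsemigroup T : Prop := forall f g, T f -> T g -> T (g \o f).

Definition generated T : set (Omega -> Omega) := smallest subsemigroup T.

Definition maximal_subsemigroup T : Prop :=
  [/\ subsemigroup T, T <> setT &
      forall s, ~ T s -> generated (T `|` [set s]) = setT].

Definition Sym : set (Omega -> Omega) := [set f | bijective f].

Definition stabiliser F : set (Omega -> Omega) :=
  [set f | Sym f /\ forall A, F A <-> F (f @` A)].

Definition transversal_of A f (X : set Omega) : Prop :=
  [/\ X `<=` A, set_inj X f & f @` X = f @` A].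

(* The cardinal c(f|_A) is represented by the complement in [A] of a chosen
   transversal; transversals exist, and the cardinality of the complement does
   not depend on the choice (it is the sum over the nonempty fibres of f|_A of
   their sizes minus one point). *)
Definition collapse A f : set Omega := A `\` xget set0 (transversal_of A f).

Definition defect f : set Omega := ~` range f.

Definition small_range : set (Omega -> Omega) :=
  [set f | range f #< [set: Omega]].

Definition U1 F (I : Type) (M : set I) : set (Omega -> Omega) :=
  [set f | [\/ M #<= defect f, ~ F (range f) |
              collapse setT f #< M /\ forall A, ~ F A -> ~ F (f @` A)]]
  `|` small_range.

Definition U2 F (I : Type) (M : set I) : set (Omega -> Omega) :=
  [set f | [\/ M #<= collapse setT f,
              forall A, F A -> collapse A f !=set0 |
              defect f #< M /\ forall A, F A -> F (f @` A)]]
  `|` small_range.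

End Transformations.

Arguments Sym : clear implicits.

(* Main.v *)
Require Import Defs.
From mathcomp Require Import all_boot.
From mathcomp Require Import boolp classical_sets functions cardinality filter.
Local Open Scope classical_set_scope.
Local Open Scope card_scope.

(** Call a set null when it is not in [F]. Maps act on the right in the informal
    statement, so [g \o f] is the product of [f] followed by [g]; [c(f)] and
    [d(f)] are the collapse and the defect of [f].

    The whole proof is a duality between left and right ideals. For a semigroup
    [G], [full G Y] says that [G] contains the left ideal of all maps into [Y],
    and [cofull G e] that it contains the right ideal of all maps that factor
    through [e]. An element [t] of [G] carries [full G Y] to [full G (t @` Y)] and
    [cofull G e] to [cofull G (e \o t)]. So [G] contains every map as soon as some
    such image is the whole of [Omega], or some such [e \o t] is injective. The
    stabiliser of [F] moves these facts around: a bijection between null sets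
    whose complements are equipotent extends to it ([stab_extend]), because half
    of the complement of their union is still in [F] and can be fixed pointwise.

    The sets [U1 F M] and [U2 F M] are maximal. They are semigroups because
    collapse and defect behave like infinite cardinals under composition. If [G]
    contains [U1 F M] and some [s] outside it, then [G] is full on a member of [F]
    whose complement is smaller than [M]: on the range of [s] when [c(s)] is at
    least [M], and on the image of a null set when [s] sends some null set onto a
    member of [F] ([full_in_F]). The semigroup [U1 F M] itself contains a map that
    stretches such a set bijectively onto [Omega] and fixes a member of [F]
    pointwise ([retraction_fixing]), so [G] is everything. The argument for
    [U2 F M] is dual.

    Conversely let [T] be maximal, containing the stabiliser but omitting a
    permutation. Then [T] lies in no proper semigroup that contains [Sym Omega];
    applied to semigroups defined by collapse and defect alone this provides
    elements of [T] with large collapse and smaller defect, and elements with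
    large defect and smaller collapse.

    The maps with null range and full-sized defect form a left ideal [J]. If [T]
    does not contain [J] then [T] together with the products of a member of [J]
    and one of [T] is a semigroup larger than [T], hence everything, and an
    omitted permutation factors through [J] and [T]; so some element of [T] maps a
    null set bijectively onto [Omega]. Dually, if [T] misses one of the maps that
    are constant on a full-sized member of [F], then [T] contains an injection of
    [Omega] onto a null set. If both happened, the stabiliser could match the two
    null sets and [T] would contain all permutations. So [T] contains one of the
    two ideals ([null_full_or_constants]), and a descent on cardinals then removes
    the size conditions from that ideal ([null_full], [constants_in_T]).

    In the first case consider the members [D] of [F], equipotent to [Omega], on
    which [T] is full, and let [R] be the least cardinality of a complement of
    such a [D]. When there is no such [D], [T] is contained in [U1 F M] for [M]
    the successor of the cardinal of [Omega]. When [R] exceeds the cardinal of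
    [K], an element of [T] outside [U1 F R] would contradict the minimality of
    [R]. The remaining values of [R] are impossible: zero would make [T]
    everything, and otherwise minimality is contradicted by an element of [T] with
    collapse at least [R] and defect smaller than [R], and for finite [R] this
    element is a power of a surjection that is not injective. The second case is
    dual, with [R] the least collapse of a map [e] with full-sized range,
    injective on a member of [F], for which [cofull T e] holds. *)

Set Implicit Arguments.
Unset Strict Implicit.
Unset Printing Implicit Defensive.

(** * Comparing cardinals *)

(** Quantifying over propositional membership, unlike [set_inj], keeps the
    pointwise arguments below free of boolean reflection. *)
Definition injective_on {T U : Type} (A : set T) (f : T -> U) : Prop :=
  forall x y, A x -> A y -> f x = f y -> x = y.

Definition bij_on {T U : Type} (A : set T) (B : set U) (f : T -> U) : Prop :=
  [/\ forall x, A x -> B (f x), injective_on A f &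
      forall y, B y -> exists2 x, A x & f x = y].

Lemma set_injP T U (A : set T) (f : T -> U) : set_inj A f <-> injective_on A f.
Proof.
split=> [fi x y Ax Ay|fi x y /set_mem Ax /set_mem Ay]; last exact: fi.
by apply: fi; apply: mem_set.
Qed.

(** A relation is enough to witness an injection: choice inside the types of
    elements of [A] and [B] is available without assuming a point of [U]. *)
Lemma card_le_rel {T U} {A : set T} {B : set U} (R : T -> U -> Prop) :
  (forall x, A x -> exists2 y, B y & R x y) ->
  (forall x x' y, A x -> A x' -> R x y -> R x' y -> x = x') -> A #<= B.
Proof.
move=> RB Ri.
have /choice[f fP] : forall a : A, exists b : B, R (val a) (val b).
  by move=> a; have [y By Ry] := RB _ (set_valP a); exists (exist _ y (mem_set By)).
have fi : injective f.
  move=> a a' fe; apply: val_inj.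
  apply: (Ri _ _ (val (f a)) (set_valP a) (set_valP a')); first exact: fP.
  by rewrite fe; exact: fP.
apply/card_leP; have := @injfunPex _ _ [set: A] [set: B]; case=> _; apply.
by exists f => // x y _ _; exact: fi.
Qed.

Lemma card_le_map {T U} {A : set T} {B : set U} (f : T -> U) :
  (forall x, A x -> B (f x)) -> injective_on A f -> A #<= B.
Proof.
move=> fB fi; apply: (@card_le_rel _ _ _ _ (fun x y => f x = y)).
- by move=> x Ax; exists (f x) => //; apply: fB.
- by move=> x x' y Ax Ax' <- /esym; apply: fi.
Qed.

Lemma card_le_relE T U (A : set T) (B : set U) : A #<= B ->
  exists R : T -> U -> Prop,
    [/\ forall x, A x -> exists2 y, B y & R x y,
        forall x x' y, A x -> A x' -> R x y -> R x' y -> x = x' &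
        forall x y, R x y -> B y].
Proof.
move=> /card_leP[f].
exists (fun x y => exists2 a : A, val a = x & val (f a) = y); split.
- move=> x Ax; exists (val (f (SigSub (mem_set Ax)))); first exact: set_valP.
  by exists (SigSub (mem_set Ax)).
- move=> _ _ y _ _ [a <- <-] [a' <- /val_inj]; move=> /(@inj _ _ _ f) e.
  by rewrite e // inE.
- by move=> x y [a _ <-]; exact: set_valP.
Qed.

Lemma card_le_mapE T U (A : set T) (B : set U) (u : U) : A #<= B ->
  exists f : T -> U, (forall x, A x -> B (f x)) /\ injective_on A f.
Proof.
move=> /card_le_relE[R [RB Ri _]].
have /choice[f fP] : forall x, exists y, A x -> B y /\ R x y.
  move=> x; have [/RB[y By Ry]|nA] := pselect (A x); first by exists y.
  by exists u.
exists f; split=> [x /fP[]//|x y Ax Ay fe].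
apply: (Ri _ _ (f x)) => //; first by case: (fP x Ax).
by rewrite fe; case: (fP y Ay).
Qed.

Lemma card_eq_mapE T U (A : set T) (B : set U) (u : U) : A #= B ->
  exists f : T -> U, bij_on A B f.
Proof.
move=> /card_bijP[f [g fK gK]].
pose h x := if pselect (A x) is left Ax then val (f (SigSub (mem_set Ax))) else u.
have hE (a : A) : h (val a) = val (f a).
  rewrite /h; case: pselect => [Ax|]; last by case; exact: set_valP.
  by congr (val (f _)); apply: val_inj.
exists h; split.
- by move=> x Ax; rewrite -[x]/(val (SigSub (mem_set Ax) : A)) hE; exact: set_valP.
- move=> x y Ax Ay; rewrite -[x]/(val (SigSub (mem_set Ax) : A)).
  rewrite -[y]/(val (SigSub (mem_set Ay) : A)) !hE => /val_inj.
  by move/(can_inj fK) ->.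
- move=> y By; exists (val (g (SigSub (mem_set By)))); first exact: set_valP.
  by rewrite hE gK.
Qed.

Lemma card_image_on T U (A : set T) (f : T -> U) :
  injective_on A f -> f @` A #= A.
Proof. by move=> /set_injP fi; exact: inj_card_eq. Qed.

(** Comparability and well-ordering of cardinals in one stroke. A maximal set of
    choice functions that are pairwise distinct in every coordinate must exhaust
    some coordinate [i]; sending [x i] to [x j] then embeds [A i] into [A j]. *)
Lemma card_min (I : Type) (T : I -> Type) (A : forall i, set (T i)) :
  inhabited I -> exists i, forall j, A i #<= A j.
Proof.
case=> i0.
have [[i Ai0]|Ane] := pselect (exists i, A i = set0).
  by exists i => j; rewrite Ai0.
pose P (D : set (forall i, T i)) :=
  (forall x i, D x -> A i (x i)) /\
  (forall x y i, D x -> D y -> x i = y i -> x = y).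
have [|D [[DA Di] Dmax]] := @Zorn_bigcup _ P.
- move=> C CP Ctot; split=> [x i [D CD Dx]|x y i [D CD Dx] [D' CD' Dy] e].
    by have [DA _] := CP _ CD; apply: DA.
  have [DD'|D'D] := Ctot _ _ CD CD'.
    by have [_ Di] := CP _ CD'; apply: (Di x y i) => //; apply: DD'.
  by have [_ Di] := CP _ CD; apply: (Di x y i) => //; apply: D'D.
have [[i iP]|nsur] := pselect (exists i, forall y, A i y -> exists2 x, D x & x i = y).
  exists i => j; apply: (@card_le_rel _ _ _ _
    (fun y z => exists2 x, D x & x i = y /\ x j = z)).
    by move=> y /iP[x Dx e]; exists (x j); [apply: DA | exists x].
  move=> _ _ z _ _ [x Dx [<- <-]] [x' Dx' [<- e]]; 
     by rewrite (Di _ _ j Dx' Dx e).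
have out i : exists y, A i y /\ forall x, D x -> x i <> y.
  apply: contrapT => no; apply: nsur; exists i => y Ay.
  apply: contrapT => nx; apply: no; exists y; split=> // x Dx e.
  by apply: nx; exists x.
pose z i := projT1 (cid (out i)).
have zA i : A i (z i) by rewrite /z; case: cid => ? [].
have zD i x : D x -> x i <> z i by rewrite /z; case: cid => ? /= [] _ h /h.
(* If no coordinate is exhausted, the unused points form one more choice
   function. *)
exfalso; apply: (Dmax (D `|` [set z])).
  split; first by move=> x; left.
  by move=> /(_ z (or_intror erefl)) /(zD i0).
split=> [x i [/DA//|->//]|x y i [Dx|->] [Dy|->]] //.
- exact: Di.
- by move/(zD i _ Dx).
- by move/esym/(zD i _ Dy).
Qed.

Lemma card_le_total T U (A : set T) (B : set U) : A #<= B \/ B #<= A.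
Proof.
pose S := fun b : bool => if b then T else U.
pose X := fun b => if b as b0 return set (S b0) then A else B.
have [[] h] := @card_min _ S X (inhabits true).
- by left; exact: (h false).
- by right; exact: (h true).
Qed.

Lemma card_ltP T U (A : set T) (B : set U) : (A #< B) <-> ~ (B #<= A).
Proof.
split=> [[AB nAB] BA|nBA]; first by apply: nAB; exact: Cantor_Bernstein.
split; first by have [//|/nBA] := card_le_total A B.
by move=> /card_eqPle[_ /nBA].
Qed.

Lemma card_ltW T U (A : set T) (B : set U) : (A #< B) -> A #<= B.
Proof. by case. Qed.

Lemma card_lt_le_trans T U V (A : set T) (B : set U) (C : set V) :
  (A #< B) -> B #<= C -> (A #< C).
Proof.
by move=> /card_ltP nBA BC; apply/card_ltP => CA; apply: nBA; exact: card_le_trans CA.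
Qed.

Lemma card_le_lt_trans T U V (A : set T) (B : set U) (C : set V) :
  A #<= B -> (B #< C) -> (A #< C).
Proof.
by move=> AB /card_ltP nCB; apply/card_ltP => CA; apply: nCB; exact: card_le_trans AB.
Qed.

Lemma card_le_or_lt T U (A : set T) (B : set U) : A #<= B \/ (B #< A).
Proof. by have [|/card_ltP] := pselect (A #<= B); [left|right]. Qed.

Lemma card_lt_infinite T U (A : set T) (B : set U) :
  finite_set A -> infinite_set B -> (A #< B).
Proof. by move=> fA iB; apply/card_ltP => /card_le_finite /(_ fA). Qed.

Lemma card_leU_disj T U (A B : set T) (C D : set U) :
  A #<= C -> B #<= D -> (forall x, C x -> ~ D x) -> A `|` B #<= C `|` D.
Proof.
move=> /card_le_relE[R [RC Ri RE]] /card_le_relE[S [SD Si SE]] CD.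
apply: (@card_le_rel _ _ _ _ (fun x y => (A x /\ R x y) \/ (~ A x /\ S x y))).
- move=> x AB; have [Ax|nAx] := pselect (A x).
    by have [y Cy Rxy] := RC _ Ax; exists y; left.
  by case: AB => // Bx; have [y Dy Sxy] := SD _ Bx; exists y; right.
- move=> x x' y ABx ABx' [[Ax Rx]|[nAx Sx]] [[Ax' Rx']|[nAx' Sx']].
  + exact: Ri Rx'.
  + by case: (CD y); [exact: RE Rx|exact: SE Sx'].
  + by case: (CD y); [exact: RE Rx'|exact: SE Sx].
  + by case: ABx ABx' => // Bx [//|Bx']; exact: Si Sx'.
Qed.

Lemma residue_inj m k k' i j : i < m -> j < m ->
  (m * k + i = m * k' + j)%N -> i = j.
Proof.
move=> im jm e; have : (m * k + i) %% m = (m * k' + j) %% m by rewrite e.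
by rewrite ![(m * _)%N]mulnC !modnMDl !modn_small.
Qed.

(** Cover [A], up to a finite remainder, by disjoint injective sequences, using a
    maximal family of them. The terms whose index lies in two of the residue
    classes modulo 4 are numerous enough for one half: one class takes the covered
    points, the other the remainder. *)
Lemma infinite_halves T (A : set T) : infinite_set A ->
  exists B C : set T, [/\ B `<=` A, C `<=` A, (forall x, B x -> ~ C x),
    A #<= B & A #<= C].
Proof.
move=> iA.
pose P (D : set (nat -> T)) :=
  [/\ forall s k, D s -> A (s k), forall s, D s -> injective s &
      forall s s' k k', D s -> D s' -> s k = s' k' -> s = s'].
have [|D [[DA Di Dd] Dmax]] := @Zorn_bigcup _ P.
  move=> G GP Gtot; split.
  - by move=> s k [D GD Ds]; have [h _ _] := GP _ GD; exact: h.
  - by move=> s [D GD Ds]; have [_ h _] := GP _ GD; exact: h.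
  - move=> s s' k k' [D GD Ds] [D' GD' Ds'] e.
    have [DD'|D'D] := Gtot _ _ GD GD'.
      by have [_ _ h] := GP _ GD'; apply: (h s s' k k') => //; exact: DD'.
    by have [_ _ h] := GP _ GD; apply: (h s s' k k') => //; exact: D'D.
pose L := [set x | A x /\ forall s k, D s -> s k <> x].
pose Q i := [set x | exists2 s, D s & exists k, x = s (4 * k + i)%N].
have QA i : Q i `<=` A by move=> _ [s Ds [k ->]]; exact: DA.
have Qd i j : i < 4 -> j < 4 -> i <> j -> forall x, Q i x -> ~ Q j x.
  move=> i4 j4 ij x [s Ds [k ->]] [s' Ds' [k' e]]; apply: ij.
  have ss := Dd _ _ _ _ Ds Ds' e; rewrite -ss in e.
  exact: residue_inj (Di _ Ds _ _ e).
have [t At] := infinite_setN0 iA.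
have finL : finite_set L.
  apply/finite_setPn => /(card_le_mapE t)[s [sL si]].
  have sD k s' k' : D s' -> s' k' = s k -> False.
    by move=> Ds' e; have [_ /(_ s' k' Ds')] := sL k I.
  apply: (Dmax (D `|` [set s])); first split; first by move=> x; left.
    by move=> /(_ s (or_intror erefl)) Ds; exact: (sD 0 s 0 Ds).
  split.
  - by move=> s' k [/DA//|->]; have [] := sL k I.
  - by move=> s' [/Di//|->] x y; exact: si.
  - move=> s1 s2 k1 k2 [D1|->] [D2|->] e //.
    + exact: Dd e.
    + by case: (sD k2 s1 k1).
    + by case: (sD k1 s2 k2).
have [s0 Ds0] : D !=set0.
  apply: contrapT => D0; apply: iA; apply: sub_finite_set finL => x Ax.
  by split=> // s k Ds; case: D0; exists s.
have AQ i j : i < 4 -> j < 4 -> i <> j -> A #<= Q i `|` Q j.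
  move=> i4 j4 ij.
  have -> : A = (A `\` L) `|` L.
    by rewrite setUC setDUK // => x [].
  apply: card_leU_disj; last exact: Qd.
  - apply: (@card_le_rel _ _ _ _
      (fun x y => exists s k, [/\ D s, x = s k & y = s (4 * k + i)%N])).
    + move=> x [Ax nLx].
      have [s Ds [k <-]] : exists2 s, D s & exists k, s k = x.
        apply: contrapT => no; apply: nLx; split=> // s k Ds e.
        by apply: no; exists s => //; exists k.
      by exists (s (4 * k + i)%N); [exists s => //; exists k|exists s, k].
    + move=> _ _ y _ _ [s [k [Ds -> ->]]] [s' [k' [Ds' -> e]]].
      have ss := Dd _ _ _ _ Ds Ds' e; rewrite -ss in e *.
      by move/(Di _ Ds)/addIn/eqP: e; rewrite eqn_mul2l => /eqP ->.
  - apply: (card_le_trans (finite_set_countable finL)).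
    apply: (@card_le_map _ _ _ _ (fun k => s0 (4 * k + j)%N)).
    + by move=> k _; exists s0 => //; exists k.
    + by move=> k k' _ _ /(Di _ Ds0)/addIn/eqP; rewrite eqn_mul2l => /eqP.
exists (Q 0 `|` Q 1), (Q 2 `|` Q 3); split; try exact: AQ.
- by move=> x [] /QA.
- by move=> x [] /QA.
- by move=> x [Qx|Qx] [Qy|Qy]; move: Qy; apply: Qd Qx.
Qed.

Lemma card_leU T U (A B : set T) (C : set U) : infinite_set C ->
  A #<= C -> B #<= C -> A `|` B #<= C.
Proof.
move=> /infinite_halves[C1 [C2 [s1 s2 dj C1C C2C]]] AC BC.
apply: card_le_trans (card_leU_disj (card_le_trans AC C1C) (card_le_trans BC C2C) dj) _.
by apply: subset_card_le => x [/s1|/s2].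
Qed.

Lemma card_ltU T U (A B : set T) (C : set U) : infinite_set C ->
  (A #< C) -> (B #< C) -> (A `|` B #< C).
Proof.
move=> iC.
wlog AB : A B / A #<= B.
  move=> wl AC BC; have [AB|BA] := card_le_total A B; first exact: wl.
  by rewrite setUC; exact: wl.
move=> AC BC; have [fB|iB] := pselect (finite_set B).
  apply: card_lt_infinite iC; rewrite finite_setU; split=> //.
  exact: card_le_finite fB.
by apply: card_le_lt_trans BC; apply: card_leU.
Qed.

Lemma card_image_lt T U V (f : T -> U) (A : set T) (C : set V) :
  (A #< C) -> (f @` A #< C).
Proof. by apply: card_le_lt_trans; exact: card_image_le. Qed.

Lemma sub_card_lt T V (A B : set T) (C : set V) : A `<=` B -> (B #< C) -> (A #< C).
Proof. by move=> /subset_card_le; exact: card_le_lt_trans. Qed.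

Lemma card_lt_irr T (A : set T) : ~ (A #< A).
Proof. by case. Qed.

Lemma card_le_not_lt T U (A : set T) (B : set U) : A #<= B -> ~ (B #< A).
Proof. by move=> AB /card_ltP. Qed.

Lemma infinite_card_le T U (A : set T) (B : set U) :
  A #<= B -> infinite_set A -> infinite_set B.
Proof. by move=> AB iA /(card_le_finite AB). Qed.

(** The powerset exceeds [A] by Cantor's argument, so the minimum of the cardinals
    of sets of subsets that exceed [A] exists. *)
Lemma succ_card_exists T (A : set T) : exists (K : Type) (S : set K), is_succ_card A S.
Proof.
pose G := {C : set (set T) | A #< C}.
have ltP : A #< [set: set T].
  apply/card_ltP => /card_le_relE[R [RA Ri _]].
  pose X := [set a | exists2 Y : set T, R Y a & ~ Y a].
  have [a _ RXa] := RA X I.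
  have nXa : ~ X a by move=> Xa; have [Y RYa] := Xa; rewrite (Ri _ _ _ I I RYa RXa).
  by apply: (nXa); exists X.
have [[S AS] Smin] :=
  @card_min G (fun=> set T) (fun C => sval C) (inhabits (exist _ _ ltP)).
exists (set T), S; split=> // K C AC.
have [//|/(card_le_mapE A)[f [fS fi]]] := card_le_total S C.
have fC := card_image_on fi.
have AfC : A #< f @` C.
  by apply: card_lt_le_trans AC _; have /card_eqPle[] := fC.
apply: card_le_trans (Smin (exist _ _ AfC)) _.
by have /card_eqPle[] := fC.
Qed.

(** * Transversals, collapse and defect *)

Section Maps.
Variable Omega : Type.
Implicit Types (f g : Omega -> Omega) (A B X Z : set Omega).

Lemma injective_on0 f : injective_on set0 f.
Proof. by []. Qed.

Lemma transversal_extend A Z f : Z `<=` A -> injective_on Z f ->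
  exists2 X, transversal_of A f X & Z `<=` X.
Proof.
move=> ZA Zi.
have /choice[r rP] : forall y, exists x, (f @` A) y -> A x /\ f x = y.
  move=> y; have [[x Ax e]|no] := pselect ((f @` A) y); first by exists x.
  by exists y => /no.
exists (Z `|` [set r y | y in f @` A `\` f @` Z]); last by move=> x; left.
split.
- by move=> x [/ZA//|[y [/rP[] // Ay _ _ <-]]].
- apply/set_injP => x x' [Zx|[y [Ay nZy] <-]] [Zx'|[y' [Ay' nZy'] <-]].
  + exact: Zi.
  + by have [_ ->] := rP _ Ay' => e; case: nZy'; exists x.
  + by have [_ ->] := rP _ Ay => e; case: nZy; exists x'.
  + by have [_ ->] := rP _ Ay; have [_ ->] := rP _ Ay' => ->.
- apply/seteqP; split.
    move=> _ [x [Zx|[y [Ay _] <-]] <-]; first by exists x => //; exact: ZA.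
    by have [_ ->] := rP _ Ay.
  move=> y Ay; have [[z Zz <-]|nZy] := pselect ((f @` Z) y).
    by exists z => //; left.
  by exists (r y); [right; exists y|have [] := rP _ Ay].
Qed.

Lemma collapse_transversal A f :
  exists2 X, transversal_of A f X & collapse A f = A `\` X.
Proof.
exists (xget set0 (transversal_of A f)) => //; apply: xgetPex.
by have [X XA _] := @transversal_extend A set0 f (@sub0set _ _) (@injective_on0 f);
  exists X.
Qed.

(** A transversal of [f] on [A] exhausts [A] exactly when [f] is injective there. *)
Lemma collapse_neq0 A f : collapse A f !=set0 <-> ~ injective_on A f.
Proof.
have [X [XA /set_injP Xi Xf] XE] := collapse_transversal A f.
rewrite XE; split.
- move=> [x [Ax nXx]] Ai.
  have [y Xy e] : (f @` X) (f x) by rewrite Xf; exists x.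
  by apply: nXx; rewrite -(Ai _ _ (XA _ Xy) Ax e).
- move=> nAi; apply: contrapT => e; apply: nAi => x y Ax Ay.
  have AX z : A z -> X z by move=> Az; apply: contrapT => nXz; apply: e; exists z.
  by apply: Xi; apply: AX.
Qed.

Lemma collapseT f :
  exists X, [/\ collapse setT f = ~` X, injective_on X f &
    forall x, exists2 y, X y & f y = f x].
Proof.
have [X [_ /set_injP Xi Xf] ->] := collapse_transversal setT f.
exists X; split=> //; first by rewrite setTD.
by move=> x; have : (f @` X) (f x) by rewrite Xf; exists x.
Qed.

(** A point outside [X] is kept if it is also outside [Z]; otherwise it is
    replaced by a point of [X] in its fibre, which cannot lie in [Z] because [Z]
    has only one point in each fibre. Applied to a transversal [X], this shows
    that the collapse is independent of the transversal and minimal among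
    complements of sets where [f] is injective. *)
Lemma transversal_min f X Z : (forall x, exists2 y, X y & f y = f x) ->
  injective_on Z f -> ~` X #<= ~` Z.
Proof.
move=> Xf Zi.
apply: (@card_le_rel _ _ _ _
  (fun x y => (~ Z x /\ y = x) \/ [/\ Z x, X y & f y = f x])).
- move=> x nXx; have [Zx|nZx] := pselect (Z x); last by exists x => //; left.
  have [y Xy e] := Xf x; exists y; last by right.
  by move=> Zy; apply: nXx; rewrite -(Zi _ _ Zy Zx e).
- move=> x x' y nXx nXx' [[nZx ->]|[Zx Xy e]] [[nZx' xx']|[Zx' Xy' e']] //.
  + by case: nXx'; rewrite -xx'.
  + by rewrite e in e'; exact: Zi.
Qed.

Lemma collapse_le f Z : injective_on Z f -> collapse setT f #<= ~` Z.
Proof. by move=> Zi; have [X [-> _ Xf]] := collapseT f; exact: transversal_min Zi. Qed.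

Lemma collapse_ge f X :
  (forall x, exists2 y, X y & f y = f x) -> ~` X #<= collapse setT f.
Proof. by move=> Xf; have [Y [-> Yi _]] := collapseT f; exact: transversal_min Yi. Qed.

Lemma transversalT f Z : injective_on Z f -> exists X,
  [/\ Z `<=` X, injective_on X f & forall x, exists2 y, X y & f y = f x].
Proof.
move=> Zi; have [X [_ /set_injP Xi Xf] ZX] := transversal_extend (@subsetT _ Z) Zi.
exists X; split=> // x.
by have : (f @` X) (f x) by rewrite Xf; exists x.
Qed.

Lemma card_le_inj_preimage f X B : injective_on X f -> X `&` f @^-1` B #<= B.
Proof.
move=> Xi; apply: (@card_le_map _ _ _ _ f); first by move=> x [].
by move=> x y [Xx _] [Xy _]; exact: Xi.
Qed.

Section Composition.
Variables (I : Type) (M : set I) (iM : infinite_set M).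

Lemma collapse_comp_ge f g : collapse setT f #<= collapse setT (g \o f).
Proof.
have [Z [-> Zi _]] := collapseT (g \o f); apply: collapse_le => x y Zx Zy e.
by apply: Zi => //=; rewrite e.
Qed.

Lemma collapse_comp_lt f g : (collapse setT f #< M) -> (collapse setT g #< M) ->
  (collapse setT (g \o f) #< M).
Proof.
have [X [-> Xi _]] := collapseT f; have [Y [-> Yi _]] := collapseT g => XM YM.
apply: card_le_lt_trans (@collapse_le _ (X `&` f @^-1` Y) _) _.
  by move=> x y [Xx Yx] [Xy Yy] /= /(Yi _ _ Yx Yy); exact: Xi.
apply: (@sub_card_lt _ _ _ (~` X `|` (X `&` f @^-1` (~` Y)))).
  by move=> x nXY; have [Xx|] := pselect (X x); [right; split=> // Yx; apply: nXY|left].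
by apply: card_ltU => //; apply: card_le_lt_trans YM; exact: card_le_inj_preimage.
Qed.

Lemma defect_comp_ge f g : defect g #<= defect (g \o f).
Proof. by apply: subset_card_le => y ny [x _ e]; apply: ny; exists (f x). Qed.

Lemma defect_comp_lt f g : (defect f #< M) -> (defect g #< M) -> (defect (g \o f) #< M).
Proof.
move=> fM gM; apply: (@sub_card_lt _ _ _ (defect g `|` g @` defect f)).
  move=> y ny; have [[x _ e]|] := pselect (range g y); last by left.
  right; exists x => // -[z _ e']; apply: ny; exists z => //=; by rewrite e'.
by apply: card_ltU => //; exact: card_image_lt.
Qed.

(** A transversal of the product is mapped by [f] to a set where [g] is injective;
    the points it misses lie outside the range of [f] or in the image of the
    points missed by the transversal. *)
Lemma collapse_comp_cancel f g : (defect f #< M) -> (collapse setT (g \o f) #< M) ->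
  (collapse setT g #< M).
Proof.
have [Z [-> Zi _]] := collapseT (g \o f) => fM ZM.
apply: card_le_lt_trans (@collapse_le _ (f @` Z) _) _.
  by move=> _ _ [x Zx <-] [y Zy <-] e; congr f; exact: Zi.
apply: (@sub_card_lt _ _ _ (defect f `|` f @` (~` Z))).
  move=> y ny; have [[x _ e]|] := pselect (range f y); last by left.
  by right; exists x => // Zx; apply: ny; exists x.
by apply: card_ltU => //; exact: card_image_lt.
Qed.

(** Choose a transversal of [g] that represents the points of [g @` range f]
    inside [range f]. A representative outside [range f] is then sent outside the
    range of the product. *)
Lemma defect_comp_cancel f g : (collapse setT g #< M) -> (defect (g \o f) #< M) ->
  (defect f #< M).
Proof.
move=> gM fgM.
have [Z [Zf /set_injP Zi Zg] _] :=
  @transversal_extend (range f) set0 g (@sub0set _ _) (@injective_on0 g).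
have [X [ZX Xi Xg]] := transversalT Zi.
apply: (@sub_card_lt _ _ _ (~` X `|` (X `&` g @^-1` defect (g \o f)))).
  move=> y ny; have [Xy|] := pselect (X y); [right; split=> //|by left].
  move=> [x _ /= e].
  have [z Zz e'] : (g @` Z) (g y) by rewrite Zg -e; exists (f x) => //; exists x.
  by apply: ny; apply: Zf; rewrite -(Xi _ _ (ZX _ Zz) Xy e').
apply: card_ltU => //; first by apply: card_le_lt_trans gM; exact: collapse_ge.
by apply: card_le_lt_trans fgM; exact: card_le_inj_preimage.
Qed.

Lemma U1_subsemigroup (F : set_system Omega) (FF : Filter F) : subsemigroup (U1 F M).
Proof.
move=> f g [Uf|sf]; last first.
  move=> _; right; apply: card_le_lt_trans sf.
  by rewrite -(image_comp f g); exact: card_image_le.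
move=> [Ug|sg]; last first.
  by right; apply: sub_card_lt sg => _ [x _ <-]; exists (f x).
left; case: Ug => [dg|rg|[cg ng]].
- by apply: Or31; exact: card_le_trans (defect_comp_ge _ _).
- by apply: Or32 => Ffg; apply: rg; apply: filterS Ffg => _ [x _ <-]; exists (f x).
- case: Uf => [df|rf|[cf nf]].
  + apply: Or31; have [//|] := card_le_or_lt M (defect (g \o f)).
    by move=> /(defect_comp_cancel cg)/(card_le_not_lt df).
  + by apply: Or32; rewrite -(image_comp f g); exact: ng.
  + apply: Or33; split; first exact: collapse_comp_lt.
    by move=> A nA; rewrite -(image_comp f g); apply/ng/nf.
Qed.

Lemma U2_subsemigroup (F : set_system Omega) : subsemigroup (U2 F M).
Proof.
move=> f g [Uf|sf]; last first.
  move=> _; right; apply: card_le_lt_trans sf.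
  by rewrite -(image_comp f g); exact: card_image_le.
move=> [Ug|sg]; last first.
  by right; apply: sub_card_lt sg => _ [x _ <-]; exists (f x).
left; case: Uf => [cf|rf|[df nf]].
- by apply: Or31; exact: card_le_trans (collapse_comp_ge _ _).
- apply: Or32 => A /rf/collapse_neq0 nA; apply/collapse_neq0 => Ai.
  by apply: nA => x y Ax Ay e; apply: Ai => //=; rewrite e.
- case: Ug => [cg|rg|[dg ng]].
  + apply: Or31; have [//|] := card_le_or_lt M (collapse setT (g \o f)).
    by move=> /(collapse_comp_cancel df)/(card_le_not_lt cg).
  + apply: Or32 => A /nf/rg/collapse_neq0 nA; apply/collapse_neq0 => Ai.
    by apply: nA => _ _ [x Ax <-] [y Ay <-] e; congr f; exact: Ai.
  + apply: Or33; split; first exact: defect_comp_lt.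
    by move=> A FA; rewrite -(image_comp f g); apply/ng/nf.
Qed.

End Composition.
End Maps.

(** * Permutations respecting a non-principal ultrafilter *)

Lemma bij_on_glue T U (A A' : set T) (B B' : set U) (f g : T -> U) :
  (forall x, A x -> ~ A' x) -> (forall y, B y -> ~ B' y) ->
  bij_on A B f -> bij_on A' B' g ->
  bij_on (A `|` A') (B `|` B') (fun x => if pselect (A x) then f x else g x).
Proof.
move=> AA' BB' [fB fi fs] [gB gi gs]; split.
- move=> x AA'x; case: pselect => [Ax|nAx]; first by left; exact: fB.
  by right; case: AA'x => // /gB.
- move=> x y Ax Ay; case: pselect => [Ax'|nAx]; case: pselect => [Ay'|nAy].
  + exact: fi.
  + by case: Ay => // /gB By /= e; case: (BB' _ (fB _ Ax')); rewrite e.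
  + by case: Ax => // /gB Bx /= e; case: (BB' _ (fB _ Ay')); rewrite -e.
  + by case: Ax => // Ax'; case: Ay => // Ay'; exact: gi.
- move=> y [/fs[x Ax <-]|/gs[x A'x <-]]; exists x; try by [left|right].
    by case: pselect.
  by case: pselect => // Ax; case: (AA' x).
Qed.

Lemma bij_on_bijective T (h : T -> T) : bij_on setT setT h -> bijective h.
Proof.
move=> [_ hi hs]; have /choice[g gP] : forall y, exists x, h x = y.
  by move=> y; have [x _ e] := hs y I; exists x.
by exists g => // x; apply: hi.
Qed.

Section Ultra.
Variables (Omega : Type) (F : set_system Omega) (K : set Omega).
Hypotheses (hOmega : infinite_set [set: Omega]) (hF : UltraFilter F)
  (hnp : forall x : Omega, F <> principal_filter x) (hK : least_card_member F K).
Implicit Types (f g h : Omega -> Omega) (A B C D E X Y : set Omega).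

(** The inequality amounts to equipotence with [Omega], as no subset exceeds
    [Omega]. *)
Definition big A := [set: Omega] #<= A.

Lemma ultra_null A : ~ F A -> F (~` A).
Proof. by have [] := in_ultra_setVsetC A hF. Qed.

Lemma ultra_nullC A : F A -> ~ F (~` A).
Proof. by move=> FA /(filterI FA); rewrite setICr; exact: filter_not_empty. Qed.

Lemma nullU A B : ~ F A -> ~ F B -> ~ F (A `|` B).
Proof.
move=> /ultra_null FA /ultra_null FB /(filterI (filterI FA FB)).
by rewrite -setCU setICl; exact: filter_not_empty.
Qed.

Lemma null_sub A B : A `<=` B -> ~ F B -> ~ F A.
Proof. by move=> AB nB FA; apply: nB; exact: filterS FA. Qed.

Lemma F_K : F K.
Proof. by case: hK. Qed.

Lemma K_le A : F A -> K #<= A.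
Proof. by case: hK => _; apply. Qed.

Lemma lt_K_null A : (A #< K) -> ~ F A.
Proof. by move=> AK /K_le /card_le_not_lt. Qed.

Lemma set1_null x : ~ F [set x].
Proof.
move=> Fx; apply: (hnp (x := x)); apply/seteqP; split=> A /=.
  move=> FA; apply/principal_filterP.
  by have [y [/= <- Ay]] := filter_ex (filterI Fx FA).
by move=> /principal_filterP Ax; apply: filterS Fx => _ ->.
Qed.

(** Singletons are null, so a finite [K] could lose a point and stay in [F]. *)
Lemma K_infinite : infinite_set K.
Proof.
move=> [[|n] Kn].
  have [x Kx] := filter_ex F_K.
  by have /card_eqPle[+ _] := Kn; rewrite II0 => /card_le0P K0; rewrite K0 in Kx.
have /eq_cardSP[x Kx Kxn] := Kn.
have FKx : F (K `\ x).
  apply: contrapT => nF; apply: (nullU nF (@set1_null x)).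
  by apply: filterS F_K => y Ky; have [->|yx] := pselect (y = x); [right|left; split].
have /card_eqPle[_ nK] := Kn; have /card_eqPle[Kxn' _] := Kxn.
have := card_le_trans nK (card_le_trans (K_le FKx) Kxn').
by rewrite card_le_II ltnn.
Qed.

Lemma F_infinite A : F A -> infinite_set A.
Proof. by move=> /K_le KA; apply: infinite_card_le KA K_infinite. Qed.

Lemma Omega_point : exists x : Omega, True.
Proof. by have [x _] := infinite_setN0 hOmega; exists x. Qed.

(** One of two disjoint halves of [A] is null, so its complement in [A] is in [F]
    while the half itself is as large as [A]. *)
Lemma halves_F A : F A -> exists B, [/\ B `<=` A, F B & A #<= A `\` B].
Proof.
move=> FA; have [B [C [BA CA BC AB AC]]] := infinite_halves (F_infinite FA).
have [FB|nFB] := pselect (F B).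
  exists B; split=> //; apply: card_le_trans AC _.
  by apply: subset_card_le => x Cx; split; [exact: CA|move=> /BC].
exists (A `\` B); split; first by move=> x [].
  by apply: filterI FA _; exact: ultra_null.
apply: card_le_trans AB _; apply: subset_card_le => x Bx.
by split; [exact: BA|move=> [_]].
Qed.

Lemma fix_stabiliser h E :
  bijective h -> F E -> (forall x, E x -> h x = x) -> stabiliser F h.
Proof.
move=> hb FE hE; split=> // A; split=> FA.
  by apply: filterS (filterI FA FE) => x [Ax Ex]; exists x => //; exact: hE.
apply: filterS (filterI FA FE) => x [[y Ay e] Ex].
by rewrite -(bij_inj hb (etrans e (esym (hE _ Ex)))).
Qed.

(** The complement of the union of [A] and [B] is in [F]; by [halves_F] it
    contains a member [E] of [F] whose removal leaves as many points. Fixing [E]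
    pointwise guarantees membership in the stabiliser, and the points outside [A]
    and [E] can be matched with those outside [B] and [E]. *)
Lemma stab_extend A B p : ~ F A -> ~ F B -> bij_on A B p -> ~` A #= ~` B ->
  exists2 h, stabiliser F h & forall x, A x -> h x = p x.
Proof.
move=> nA nB pAB cAB; have [x0 _] := Omega_point.
have FC : F (~` (A `|` B)) by apply: ultra_null; exact: nullU.
have [E [EC FE CE]] := halves_F FC.
have aux A1 B1 : A `|` B = A1 `|` B1 -> ~` A1 #= ~` (A1 `|` E).
  move=> AB1; apply: Cantor_Bernstein; last first.
    by apply: subset_card_le => x nx Ax; apply: nx; left.
  apply: (@card_le_trans _ _ _ ((B1 `\` A1) `|` ~` (A `|` B))).
    apply: subset_card_le => x nAx; have [Bx|nBx] := pselect (B1 x); first by left.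
    by right; rewrite AB1 => -[].
  apply: (@card_le_trans _ _ _ ((B1 `\` A1) `|` (~` (A `|` B) `\` E))).
    apply: card_leU_disj => //; rewrite AB1 => x [Bx _] [nx _]; by apply: nx; right.
  apply: subset_card_le => x [[Bx nAx]|[nABx nEx]].
    by move=> [//|/EC]; rewrite AB1; apply; right.
  by rewrite AB1 in nABx; move=> [Ax|//]; apply: nABx; left.
have /(card_eq_mapE x0)[q qP] : ~` (A `|` E) #= ~` (B `|` E).
  have eA : ~` A #= ~` (A `|` E) by exact: (aux A B).
  have eB : ~` B #= ~` (B `|` E) by apply: (aux B A); rewrite setUC.
  by rewrite -(card_eqr eB) -(card_eql eA).
have dj A1 : A1 `<=` A `|` B -> forall x, A1 x -> ~ (~` (A1 `|` E) `|` E) x.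
  by move=> s x Ax [|/EC/=]; [apply; left|apply; exact: s].
have dj' A1 : forall x, (~` (A1 `|` E)) x -> ~ E x by move=> x nx Ex; apply: nx; right.
have cov A1 : A1 `|` (~` (A1 `|` E) `|` E) = setT.
  apply/seteqP; split=> // x _.
  have [Ax|nAx] := pselect (A1 x); first by left.
  by right; have [Ex|nEx] := pselect (E x); [right|left; case].
have idE : bij_on E E id by split=> // y Ey; exists y.
have := bij_on_glue (dj A (@subsetUl _ _ _)) (dj B (@subsetUr _ _ _)) pAB
  (bij_on_glue (dj' A) (dj' B) qP idE).
rewrite !cov; set h := (fun x => _) => /bij_on_bijective hb.
exists h; last by move=> x Ax; rewrite /h; case: pselect.
apply: (fix_stabiliser hb FE) => x Ex; rewrite /h.
have nAx : ~ A x by move=> Ax; apply: (EC x Ex); left.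
case: pselect => [Ax|n1] /=; first by case: nAx.
case: pselect => //= nx; by case: nx; right.
Qed.

Lemma stab_move A B : ~ F A -> ~ F B -> A #= B -> ~` A #= ~` B ->
  exists2 h, stabiliser F h & h @` A = B /\ h @` (~` A) = ~` B.
Proof.
move=> nA nB AB cAB; have [x0 _] := Omega_point.
have [p pP] := card_eq_mapE x0 AB.
have [h hS hp] := stab_extend nA nB pP cAB; exists h => //.
have [hb _] := hS; have hi := bij_inj hb.
case: pP => pB _ ps.
have hAB : h @` A = B.
  apply/seteqP; split; first by move=> _ [x Ax <-]; rewrite hp //; exact: pB.
  by move=> y /ps[x Ax <-]; exists x; rewrite ?hp.
split=> //; rewrite -hAB; apply/seteqP; split.
  by move=> _ [x nAx <-] [y Ay /hi e]; apply: nAx; rewrite -e.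
case: hb => k hk kh y nBy; exists (k y); last exact: kh.
by move=> Ak; apply: nBy; exists (k y); rewrite ?kh.
Qed.

Lemma compl_big A : (A #< [set: Omega]) -> big (~` A).
Proof.
move=> lA; have [//|lC] := card_le_or_lt [set: Omega] (~` A).
by have := card_ltU hOmega lA lC; rewrite setUv => /card_lt_irr.
Qed.

(** A copy of [B] inside [A] becomes a member of [F] on adding [K `&` A], which is
    not larger than [B]. *)
Lemma F_sub_card A B : F A -> F B -> B #<= A -> exists E, [/\ E `<=` A, F E & E #= B].
Proof.
move=> FA FB BA; have [x0 _] := Omega_point.
have [f [fA fi]] := card_le_mapE x0 BA.
exists ((K `&` A) `|` f @` B); split.
- by move=> x [[]//|[y By <-]]; exact: fA.
- by apply: filterS (filterI F_K FA) => x; left.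
apply: Cantor_Bernstein.
  apply: card_leU; [exact: F_infinite| |exact: card_image_le].
  by apply: card_le_trans (K_le FB); apply: subset_card_le => x [].
apply: (@card_le_trans _ _ _ (f @` B)); first by have /card_eqPle[] := card_image_on fi.
by apply: subset_card_le => x; right.
Qed.

Lemma big_eq A B : big A -> big B -> A #= B.
Proof.
by move=> bA bB; apply: Cantor_Bernstein; apply: card_le_trans (card_leT _) _.
Qed.

Lemma big_infinite A : big A -> infinite_set A.
Proof. by move=> /infinite_card_le; apply. Qed.

(** Both maps are the identity on a member [E] of [F] with [E `<=` D], and [v]
    stretches the rest of [D] over the complement of [E]; this is why [v] sends
    null sets to null sets and [w] sends members of [F] to members of [F]. *)
Lemma retraction_fixing D : F D -> big D -> exists v w : Omega -> Omega,
  [/\ forall x, v (w x) = x, forall x, D (w x), injective_on D v &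
   (forall A, F (v @` A) -> F A) /\ (forall A, F A -> F (w @` A))].
Proof.
move=> FD bD; have [x0 _] := Omega_point; have [E [ED FE DE]] := halves_F FD.
have bDE : big (D `\` E) by exact: card_le_trans DE.
have bE : big (~` E) by apply: card_le_trans bDE _; apply: subset_card_le => x [].
have /(card_eq_mapE x0)[q [qE qi qs]] := big_eq bDE bE.
(* Outside [D] the map [v] must avoid [E], or it could send a null set onto a
   member of [F]; the identity does. *)
pose v x := if pselect ((D `\` E) x) then q x else x.
have vE x : E x -> v x = x by rewrite /v; case: pselect => // -[].
have vDE x : (D `\` E) x -> v x = q x by rewrite /v; case: pselect.
have vi : injective_on D v.
  move=> x y Dx Dy.
  have [Ex|nEx] := pselect (E x); have [Ey|nEy] := pselect (E y).
  - by rewrite !vE.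
  - by rewrite vE // vDE // => e; case: (qE y) => //; rewrite -e.
  - by rewrite vDE // vE // => e; case: (qE x) => //; rewrite e.
  - by rewrite !vDE //; exact: qi.
have vs y : exists x, D x /\ v x = y.
  have [Ey|/qs[x [Dx nEx] <-]] := pselect (E y).
    by exists y; split; [exact: ED|exact: vE].
  by exists x; split=> //; exact: vDE.
have /choice[w wP] := vs.
exists v, w; split=> //; try by move=> x; case: (wP x).
have wE x : E x -> w x = x.
  move=> Ex; apply: vi; [by case: (wP x)|exact: ED|].
  by case: (wP x) => _ ->; rewrite vE.
split=> A FA.
  apply: filterS (filterI FA FE) => y [[x Ax <-]].
  by rewrite /v; case: pselect => // Dx /qE.
by apply: filterS (filterI FA FE) => x [Ax Ex]; exists x => //; exact: wE.
Qed.

(** Exchange two equipotent halves of [K], exactly one of which is in [F]. *)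
Lemma nonstabiliser : exists s : Omega -> Omega, bijective s /\
  exists A, [/\ F A, ~ F (s @` A) & F (s @` (s @` A))].
Proof.
have [x0 _] := Omega_point; have [B [BK FB KB]] := halves_F F_K.
have KBB : K `\` B #= B.
  apply: Cantor_Bernstein; last exact: card_le_trans (subset_card_le BK) KB.
  by apply: card_le_trans (K_le FB); apply: subset_card_le => x [].
have [p pP] := card_eq_mapE x0 KBB.
have [q qP] := card_eq_mapE x0 (card_esym KBB).
have djB x : (K `\` B) x -> ~ (B `|` ~` K) x by move=> [Kx nBx] [|].
have djK x : B x -> ~ (~` K) x by move=> /BK Kx; apply.
have djB' x : B x -> ~ ((K `\` B) `|` ~` K) x.
  by move=> Bx [[_]|]; [apply|apply; exact: BK].
have djK' x : (K `\` B) x -> ~ (~` K) x by move=> [Kx _]; apply.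
have idK : bij_on (~` K) (~` K) id by split=> // y ny; exists y.
have := bij_on_glue djB djB' pP (bij_on_glue djK djK' qP idK).
have -> : (K `\` B) `|` (B `|` ~` K) = setT.
  apply/seteqP; split=> // x _; have [Bx|nBx] := pselect (B x); first by right; left.
  by have [Kx|nKx] := pselect (K x); [left|right; right].
have -> : B `|` ((K `\` B) `|` ~` K) = setT.
  apply/seteqP; split=> // x _; have [Bx|nBx] := pselect (B x); first by left.
  by right; have [Kx|nKx] := pselect (K x); [left|right].
set h := (fun x => _) => /bij_on_bijective hb.
have hp x : (K `\` B) x -> h x = p x by rewrite /h; case: pselect.
have hq x : B x -> h x = q x.
  move=> Bx; rewrite /h; case: pselect => [KBx|n1] /=; first by case: KBx.
  by case: pselect.
case: pP => _ _ ps; case: qP => qB _ qs.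
exists h; split=> //; exists B; split=> //.
  apply: null_sub (@ultra_nullC _ FB) => _ [x Bx <-].
  by rewrite hq //; have [] := qB x Bx.
apply: filterS FB => y /ps[x KBx <-]; have [z Bz e] := qs _ KBx.
by exists x; rewrite ?hp //; exists z; rewrite ?hq.
Qed.

End Ultra.

(** * Principal left and right ideals inside a semigroup *)

(** On [e @` Y] the factor is forced; elsewhere it can be chosen constant. *)
Lemma factor_on T U V (Y : set T) (e : T -> U) (f : T -> V) (c : V) :
  (forall x y, Y x -> Y y -> e x = e y -> f x = f y) ->
  exists u : U -> V, (forall x, Y x -> u (e x) = f x) /\
    forall y, ~ (e @` Y) y -> u y = c.
Proof.
move=> ef; have /choice[u uP] : forall y, exists z,
    (forall x, Y x -> e x = y -> f x = z) /\ (~ (e @` Y) y -> z = c).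
  move=> y; have [[x Yx <-]|ny] := pselect ((e @` Y) y).
    by exists (f x); split=> [x' Yx' /ef->//|[]]; exists x.
  by exists c; split=> // x Yx ex; case: ny; exists x.
exists u; split=> [x Yx|y ny]; first by have [+ _] := uP (e x); move/(_ x Yx erefl).
by have [_] := uP y; apply.
Qed.

Section Semigroup.
Variables (Omega : Type) (F : set_system Omega) (K : set Omega).
Hypotheses (hOmega : infinite_set [set: Omega]) (hF : UltraFilter F)
  (hnp : forall x : Omega, F <> principal_filter x) (hK : least_card_member F K).
Variable (G : set (Omega -> Omega)).
Hypothesis (hG : subsemigroup G).
Implicit Types (e f g h s t u : Omega -> Omega) (A B D E S X Y : set Omega).

Definition full Y := forall f, (forall x, Y (f x)) -> G f.
Definition cofull e := forall u, G (u \o e).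
Definition constant_on E f := forall x y, E x -> E y -> f x = f y.

Lemma full_sub X Y : X `<=` Y -> full Y -> full X.
Proof. by move=> XY fY f fX; apply: fY => x; apply: XY. Qed.

Lemma full_image t Y : G t -> full Y -> full (t @` Y).
Proof.
move=> Gt fY f ftY; have /choice[u uP] : forall x, exists y, Y y /\ t y = f x.
  by move=> x; have [y Yy e] := ftY x; exists y.
have -> : f = t \o u by apply/funext => x; have [_ <-] := uP x.
by apply: hG => //; apply: fY => x; case: (uP x).
Qed.

Lemma cofull_comp e t : G t -> cofull e -> cofull (e \o t).
Proof. by move=> Gt ce u; exact: (hG Gt (ce u)). Qed.

Lemma cofull_injective e : cofull e -> injective e -> forall f, G f.
Proof.
move=> ce ei f; have [x0 _] := Omega_point hOmega.
have [x y _ _ /ei->//|u [uf _]] := @factor_on _ _ _ setT e f x0.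
have -> : f = u \o e by apply/funext => x; rewrite /= uf.
exact: ce.
Qed.

Lemma big_image_transversal f X : big (range f) ->
  (forall x, exists2 y, X y & f y = f x) -> big X.
Proof.
move=> bf Xf; apply: card_le_trans bf _; apply: card_le_trans (card_image_le f X).
by apply: subset_card_le => _ [x _ <-]; have [y Xy <-] := Xf x; exists y.
Qed.

(** Enlarging [S] by the null set [~` K] makes the image miss at most [f @` K]
    inside the range of [f]. The image has full size since it misses fewer points
    of the range of [f] than [Omega] has, unless [K] itself has full size, and
    then every member of [F] has. *)
Lemma full_in_F f S : (forall Y, ~ F Y -> full Y) ->
  G f -> big (range f) -> ~ F S -> F (f @` S) ->
  exists D, [/\ F D, big D, full D & ~` D `<=` defect f `|` f @` K].
Proof.
move=> fnull Gf bf nS FS; exists (f @` (S `|` ~` K)).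
have FD : F (f @` (S `|` ~` K)) by apply: filterS FS; apply: image_subset => x; left.
have cov : ~` (f @` (S `|` ~` K)) `<=` defect f `|` f @` K.
  move=> y ny; have [[x _ e]|] := pselect (range f y); last by left.
  right; exists x => //; apply: contrapT => nKx; apply: ny; exists x => //.
  by right.
split=> //; last first.
  apply: full_image => //; apply: fnull; apply: nullU => //.
  by apply: ultra_nullC; case: hK.
have [bK|K_lt] := card_le_or_lt [set: Omega] K.
  exact: card_le_trans bK (K_le hK FD).
have [//|D_lt] := card_le_or_lt [set: Omega] (f @` (S `|` ~` K)).
exfalso; apply: (card_le_not_lt bf).
apply: (@sub_card_lt _ _ _ (f @` (S `|` ~` K) `|` f @` K)).
  move=> y [x _ <-]; have [Kx|nKx] := pselect (K x); [right|left]; exists x => //.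
  by right.
by apply: card_ltU => //; exact: card_image_lt.
Qed.

(** Dual of [full_in_F]. Let [u0] collapse to a point the part [W] of [K] outside
    [f @` D], which is in [F]. Every map factoring through [u0] is constant on
    [W], hence in [G], so [u0 \o f] is the required map; [u0] moves no point of
    [f @` D], and it collapses no more than [K]. *)
Lemma cofull_collapsing f D : (forall E, F E -> forall f, constant_on E f -> G f) ->
  G f -> big (range f) -> injective_on D f -> F D -> ~ F (f @` D) ->
  exists e, [/\ cofull e, injective_on D e, big (range e) &
    forall I (M : set I), infinite_set M -> (K #< M) ->
      (collapse setT f #< M) -> (collapse setT e #< M)].
Proof.
move=> Gcst Gf bf Di FD nfD.
pose W := K `\` f @` D.
have FW : F W by apply: filterI; [case: hK|exact: ultra_null].
have [w0 Ww0] := filter_ex FW.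
pose u0 x := if pselect (W x) then w0 else x.
have u0W x : W x -> u0 x = w0 by rewrite /u0; case: pselect.
have u0nW x : ~ W x -> u0 x = x by rewrite /u0; case: pselect.
have nWD x : D x -> ~ W (f x) by move=> Dx [_]; apply; exists x.
have ei : injective_on D (u0 \o f).
  by move=> x y Dx Dy /=; rewrite !u0nW; [exact: Di|exact: nWD|exact: nWD].
exists (u0 \o f); split=> //.
- move=> u; apply: (hG Gf (g := u \o u0)); apply: (Gcst _ FW) => x y Wx Wy /=.
  by rewrite !u0W.
- have [bK|K_lt] := card_le_or_lt [set: Omega] K.
    apply: card_le_trans bK (card_le_trans (K_le hK FD) _).
    by apply: (card_le_map (f := u0 \o f)) => // x _; exists x.
  have [//|e_lt] := card_le_or_lt [set: Omega] (range (u0 \o f)).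
  exfalso; apply: (card_le_not_lt bf).
  apply: (@sub_card_lt _ _ _ (range (u0 \o f) `|` K)); last exact: card_ltU.
  move=> _ [x _ <-]; have [[Kx _]|nWx] := pselect (W (f x)); first by right.
  by left; exists x => //=; rewrite u0nW.
- move=> I M iM KM; have [X [-> Xi _]] := collapseT f => XM.
  apply: card_le_lt_trans (@collapse_le _ _ (X `&` f @^-1` (~` W)) _) _.
    by move=> x y [Xx nWx] [Xy nWy] /=; rewrite !u0nW //; exact: Xi.
  apply: (@sub_card_lt _ _ _ (~` X `|` (X `&` f @^-1` W))).
    move=> x nXW; have [Xx|] := pselect (X x); last by left.
    by right; split=> //; apply: contrapT => nW; apply: nXW.
  apply: card_ltU => //; apply: card_le_lt_trans KM.
  by apply: card_le_trans (card_le_inj_preimage W Xi) _; apply: subset_card_le => x [].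
Qed.

Section Generation.
Variables (I : Type) (M : set I).
Hypothesis (iM : infinite_set M).

(** By [retraction_fixing], a map whose collapse is smaller than [M] and that
    respects null sets sends [D] onto [Omega]. *)
Lemma full_total D : (forall v, (collapse setT v #< M) ->
    (forall A, ~ F A -> ~ F (v @` A)) -> G v) ->
  F D -> big D -> full D -> (~` D #< M) -> forall f, G f.
Proof.
move=> Gv FD bD fD DM f.
have [v [w [vw wD vi [vF _]]]] := retraction_fixing hOmega hF hnp hK FD bD.
have Gv' : G v.
  apply: Gv; first by apply: card_le_lt_trans DM; exact: collapse_le.
  by move=> A nA /vF.
by apply: (full_image Gv' fD) => x; exists (w (f x)).
Qed.

(** Precompose [e] with an injection onto a transversal of [e] that belongs to
    [F]; this injection has defect [c(e)] and preserves [F]. *)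
Lemma cofull_total e D : (forall w, (defect w #< M) ->
    (forall A, F A -> F (w @` A)) -> G w) ->
  cofull e -> injective_on D e -> F D -> big (range e) -> (collapse setT e #< M) ->
  forall f, G f.
Proof.
move=> Gw ce Di FD be eM.
have [X [DX Xi Xe]] := transversalT Di.
have FX : F X by exact: filterS FD.
have [v [w [vw wX vi [_ wF]]]] :=
  retraction_fixing hOmega hF hnp hK FX (big_image_transversal be Xe).
have wi : injective w by exact: can_inj vw.
apply: (@cofull_injective (e \o w)); last by move=> x y /(Xi _ _ (wX _) (wX _)) /wi.
apply: cofull_comp => //; apply: Gw => //.
apply: card_le_lt_trans eM; apply: card_le_trans (collapse_ge Xe).
apply: subset_card_le => x nx Xx; apply: nx; exists (v x) => //.
by apply: vi => //; rewrite vw.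
Qed.

Lemma notU1P s : ~ U1 F M s <-> [/\ defect s #< M, F (range s), big (range s) &
  M #<= collapse setT s \/ exists2 A, ~ F A & F (s @` A)].
Proof.
split.
  move=> nU; have [dM|dM] := card_le_or_lt M (defect s).
    by case: nU; left; apply: Or31.
  have Fs : F (range s) by apply: contrapT => nF; case: nU; left; apply: Or32.
  split=> //.
    by have [//|lt] := card_le_or_lt [set: Omega] (range s); case: nU; right.
  have [cM|cM] := card_le_or_lt M (collapse setT s); first by left.
  right; apply: contrapT => no; case: nU; left; apply: Or33; split=> // A nA FA.
  by apply: no; exists A.
move=> [dM Fs bs cA] [[/card_le_not_lt|/(_ Fs)|[cM An]]|/(card_le_not_lt bs)] //.
by case: cA => [/card_le_not_lt/(_ cM)//|[A nA FA]]; exact: (An A).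
Qed.

Lemma notU2P s : ~ U2 F M s <-> [/\ collapse setT s #< M,
  exists2 D, F D & injective_on D s, big (range s) &
  M #<= defect s \/ exists2 A, F A & ~ F (s @` A)].
Proof.
split.
  move=> nU; have [cM|cM] := card_le_or_lt M (collapse setT s).
    by case: nU; left; apply: Or31.
  have Di : exists2 D, F D & injective_on D s.
    apply: contrapT => no; case: nU; left; apply: Or32 => A FA.
    apply/collapse_neq0 => Ai.
    by apply: no; exists A.
  split=> //.
    by have [//|lt] := card_le_or_lt [set: Omega] (range s); case: nU; right.
  have [dM|dM] := card_le_or_lt M (defect s); first by left.
  right; apply: contrapT => no; case: nU; left; apply: Or33; split=> // A FA.
  by apply: contrapT => nA; apply: no; exists A.
move=> [cM [D FD Di] bs dA].
move=> [[/card_le_not_lt//|/(_ D FD)/collapse_neq0|[dM An]]|/(card_le_not_lt bs)] //.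
by case: dA => [/card_le_not_lt/(_ dM)//|[A FA nA]]; apply/nA/An.
Qed.

(** If [c(s)] is at least [M], all maps into a transversal of [s] have defect at
    least [M], so [G] is full on the range of [s]. Otherwise [full_in_F] applies.
    Either way [G] is full on a member of [F] that [full_total] can stretch to
    [Omega]. *)
Lemma U1_generates s : U1 F M `<=` G -> ~ U1 F M s -> G s -> (K #< M) -> forall f, G f.
Proof.
move=> UG /notU1P[dM Fs bs cA] Gs KM.
have fnull Y : ~ F Y -> full Y.
  move=> nY f fY; apply: UG; left; apply: Or32; apply: null_sub nY.
  by move=> _ [x _ <-].
have Gv v : (collapse setT v #< M) -> (forall A, ~ F A -> ~ F (v @` A)) -> G v.
  by move=> vM vA; apply: UG; left; apply: Or33.
case: cA => [cM|[A nA FA]].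
  apply: (full_total Gv Fs bs) => //.
  (* A map into the transversal [X] misses its complement, which has the
     cardinality of the collapse of [s]. *)
  have [X [cX _ Xs]] := collapseT s.
  have fX : full X.
    move=> f fX; apply: UG; left; apply: Or31; apply: card_le_trans cM _; rewrite cX.
    by apply: subset_card_le => x nXx [y _ e]; apply: nXx; rewrite -e.
  apply: full_sub (full_image Gs fX) => _ [x _ <-].
  by have [y Xy <-] := Xs x; exists y.
have [D [FD bD fD Dsub]] := full_in_F fnull Gs bs nA FA.
apply: (full_total Gv FD bD fD); apply: sub_card_lt Dsub _.
by apply: card_ltU => //; exact: card_image_lt.
Qed.

(** If [d(s)] is at least [M], a map prescribed on the range of [s] and constant
    elsewhere has collapse at least [M], so [cofull G s] holds. Otherwise
    [cofull_collapsing] applies. Either way [cofull_total] concludes. *)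
Lemma U2_generates s : U2 F M `<=` G -> ~ U2 F M s -> G s -> (K #< M) -> forall f, G f.
Proof.
move=> UG /notU2P[cM [D FD Di] bs dA] Gs KM; have [x0 _] := Omega_point hOmega.
have Gcst E : F E -> forall f, constant_on E f -> G f.
  move=> FE f fE; apply: UG; left; apply: Or32 => A FA; apply/collapse_neq0 => Ai.
  have := F_infinite hF hnp hK (filterI FA FE); apply.
  have [x [Ax Ex]] := filter_ex (filterI FA FE).
  apply: sub_finite_set (finite_set1 x) => y [Ay Ey] /=.
  by apply: Ai => //; exact: fE.
have Gw w : (defect w #< M) -> (forall A, F A -> F (w @` A)) -> G w.
  by move=> wM wA; apply: UG; left; apply: Or33.
case: dA => [dM|[A FA nA]].
  apply: (cofull_total Gw _ Di) => // u.
  have [x y _ _ /(congr1 u)//|u' [u's u'c]] := @factor_on _ _ _ setT s (u \o s) x0.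
  have -> : u \o s = u' \o s by apply/funext => x; rewrite /= u's.
  apply: hG => //; apply: UG; left; apply: Or31.
  have [//|u'M] := card_le_or_lt M (collapse setT u'); exfalso.
  have [Z [cZ Zi _]] := collapseT u'; rewrite cZ in u'M.
  apply: (card_le_not_lt dM).
  apply: (@sub_card_lt _ _ _ (~` Z `|` (Z `&` defect s))).
    by move=> x dx; have [Zx|] := pselect (Z x); [right|left].
  apply: card_ltU => //; apply: card_lt_infinite iM.
  have [[z [Zz dz]]|Z0] := pselect ((Z `&` defect s) !=set0); last first.
    suff -> : Z `&` defect s = set0 by exact: finite_set0.
    by apply/seteqP; split=> // x Zx; apply: Z0; exists x.
  apply: sub_finite_set (finite_set1 z) => y [Zy dy] /=; apply: Zi => //.
  by rewrite !u'c.
have FDA : F (D `&` A) by exact: filterI.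
have DAi : injective_on (D `&` A) s by move=> x y [Dx _] [Dy _]; exact: Di.
have nDA : ~ F (s @` (D `&` A)) by apply: null_sub nA; apply: image_subset => x [].
have [e [ce ei be eM]] := cofull_collapsing Gcst Gs bs DAi FDA nDA.
by apply: (cofull_total Gw ce ei) => //; exact: eM.
Qed.

End Generation.
End Semigroup.

(** * Maximality of [U1] and [U2] *)

Section Maximality.
Variables (Omega : Type) (F : set_system Omega) (K : set Omega).
Hypotheses (hOmega : infinite_set [set: Omega]) (hF : UltraFilter F)
  (hnp : forall x : Omega, F <> principal_filter x) (hK : least_card_member F K).
Variables (I : Type) (M : set I).
Hypothesis (iM : infinite_set M) (KM : K #< M).

Lemma card_set0_lt (A : set Omega) : A = set0 -> (A #< M).
Proof. by move=> ->; apply: card_lt_infinite iM; exact: finite_set0. Qed.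

Lemma range_bijective (s : Omega -> Omega) : bijective s -> range s = setT.
Proof. by move=> [r sr rs]; apply/seteqP; split=> // y _; exists (r y). Qed.

Lemma defect_bijective (s : Omega -> Omega) : bijective s -> defect s = set0.
Proof. by move=> /range_bijective sT; rewrite /defect sT setCT. Qed.

Lemma collapse_bijective (s : Omega -> Omega) : bijective s -> collapse setT s = set0.
Proof.
move=> /bij_inj si; apply: contrapT => /eqP/set0P/collapse_neq0; apply.
by move=> x y _ _ /si.
Qed.

Lemma Sym_notU1 : ~ (Sym Omega `<=` U1 F M).
Proof.
have [s [sb [A [FA nsA FssA]]]] := nonstabiliser hOmega hF hnp hK.
move=> /(_ s sb); apply/notU1P; split.
- by apply: card_set0_lt; exact: defect_bijective.
- by rewrite range_bijective //; exact: filterT.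
- by rewrite range_bijective //; exact: card_lexx.
- by right; exists (s @` A).
Qed.

Lemma Sym_notU2 : ~ (Sym Omega `<=` U2 F M).
Proof.
have [s [sb [A [FA nsA _]]]] := nonstabiliser hOmega hF hnp hK.
move=> /(_ s sb); apply/notU2P; split.
- by apply: card_set0_lt; exact: collapse_bijective.
- by exists setT; [exact: filterT|move=> x y _ _ /(bij_inj sb)].
- by rewrite range_bijective //; exact: card_lexx.
- by right; exists A.
Qed.

Lemma stabiliser_U1 : stabiliser F `<=` U1 F M.
Proof.
move=> s [sb sF]; left; apply: Or33; split; last first.
  by move=> A nA FsA; case: (sF A) => _ /(_ FsA).
by apply: card_set0_lt; exact: collapse_bijective.
Qed.

Lemma stabiliser_U2 : stabiliser F `<=` U2 F M.
Proof.
move=> s [sb sF]; left; apply: Or33; split; last first.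
  by move=> A FA; case: (sF A) => /(_ FA).
by apply: card_set0_lt; exact: defect_bijective.
Qed.

Lemma maximal_of_generates (U : set (Omega -> Omega)) :
  subsemigroup U -> ~ (Sym Omega `<=` U) ->
  (forall G s, subsemigroup G -> U `<=` G -> ~ U s -> G s -> forall f, G f) ->
  maximal_subsemigroup U.
Proof.
move=> Us nU gen; split=> //; first by move=> UT; apply: nU; rewrite UT.
move=> s ns; apply/seteqP; split=> // f _ G [Gs GU].
by apply: (gen G s) => // [g Ug|]; apply: GU; [left|right].
Qed.

Lemma U1_maximal : maximal_subsemigroup (U1 F M).
Proof.
apply: maximal_of_generates; [exact: U1_subsemigroup|exact: Sym_notU1|].
by move=> G s Gs UG ns Gss f; exact: (U1_generates hOmega hF hnp hK Gs iM UG ns).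
Qed.

Lemma U2_maximal : maximal_subsemigroup (U2 F M).
Proof.
apply: maximal_of_generates; [exact: U2_subsemigroup|exact: Sym_notU2|].
by move=> G s Gs UG ns Gss f; exact: (U2_generates hOmega hF hnp hK Gs iM UG ns).
Qed.

End Maximality.

(** * Elements of a maximal subsemigroup that omits a permutation *)

Lemma iter_injective (T : Type) (r : T -> T) k : injective r -> injective (iter k r).
Proof. by move=> ri; elim: k => // k IH x y /= /ri /IH. Qed.

(** The points [x], [r x], [r (r x)] and so on are distinct, and the first [k] of
    them are outside the range of the [k]-th iterate. *)
Lemma iter_defect (T : Type) (r : T -> T) x k :
  injective r -> ~ range r x -> `I_k #<= ~` range (iter k r).
Proof.
move=> ri nx.
have low i j z : i < j -> iter i r x <> iter j r z.
  move=> ij; rewrite -(subnKC (ltnW ij)) iterD => /(iter_injective ri).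
  have : 0 < (j - i)%N by rewrite subn_gt0.
  case: (j - i)%N => // n _ e; apply: nx; by exists (iter n r z).
apply: (card_le_map (f := fun i => iter i r x)) => [i ik [z _ e]|i j ik jk e].
  by apply: (low i k z ik).
by have [/low h|/low h|//] := ltngtP i j; [case: (h x)|case: (h x)].
Qed.

Section OmittedPermutation.
Variables (Omega : Type) (hOmega : infinite_set [set: Omega]).
Variable T : set (Omega -> Omega).
Hypotheses (hT : maximal_subsemigroup T) (hSym : ~ (Sym Omega `<=` T)).

Lemma maximal_escape (S : set (Omega -> Omega)) s :
  subsemigroup S -> T `<=` S -> S s -> ~ T s -> forall f, S f.
Proof.
move=> hS TS Ss nTs f; have [_ _ /(_ s nTs) gen] := hT.
have : generated (T `|` [set s]) f by rewrite gen.
by apply; split=> // g [/TS|->].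
Qed.

Lemma Sym_outside : exists2 s, bijective s & ~ T s.
Proof.
apply: contrapT => no; apply: hSym => s sb; apply: contrapT => nTs.
by apply: no; exists s.
Qed.

(** If [T] were contained in [S], adjoining to [T] an omitted permutation, which
    lies in [S], would generate everything inside [S]. *)
Lemma maximal_not_sub (S : set (Omega -> Omega)) f :
  subsemigroup S -> Sym Omega `<=` S -> ~ S f -> exists2 t, T t & ~ S t.
Proof.
move=> hS SymS nSf; have [s sb nTs] := Sym_outside.
apply: contrapT => no; apply: nSf; apply: (maximal_escape hS _ (SymS _ sb) nTs).
by move=> t Tt; apply: contrapT => nSt; apply: no; exists t.
Qed.

Lemma maximal_eq (U : set (Omega -> Omega)) :
  subsemigroup U -> ~ (Sym Omega `<=` U) -> T `<=` U -> T = U.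
Proof.
move=> hU nU TU; apply/seteqP; split=> // f Uf; apply: contrapT => nTf.
by apply: nU => g _; exact: (maximal_escape hU TU Uf nTf).
Qed.

(** A map with full-sized defect and no collapse, and one with full-sized collapse
    and no defect; they witness that the four semigroups considered next are
    proper. *)
Lemma big_retraction : exists r p : Omega -> Omega,
  (forall x, p (r x) = x) /\ big (~` range r).
Proof.
have [x0 _] := Omega_point hOmega.
have [C1 [C2 [_ _ dj /(card_le_mapE x0)[r [rC ri]] C2b]]] := infinite_halves hOmega.
have [x y _ _ |p [pr _]] := @factor_on _ _ _ setT r id x0; first exact: ri.
exists r, p; split=> [x|]; first exact: pr.
apply: card_le_trans C2b _; apply: subset_card_le => y C2y [x _ e].
by apply: (dj y) => //; rewrite -e; exact: rC.
Qed.

(** The maps that are injective if surjective form a proper semigroup containing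
    all permutations. Dually for [injective_in_T]. *)
Lemma surjective_in_T : exists t, [/\ T t, forall y, exists x, t x = y & ~ injective t].
Proof.
pose S := [set f : Omega -> Omega | (forall y, exists x, f x = y) -> injective f].
have [r [p [pr nr]]] := big_retraction.
have [|||t Tt nSt] := @maximal_not_sub S p.
- move=> f g Sf Sg gfs; have gi : injective g.
    by apply: Sg => y; have [x <-] := gfs y; exists (f x).
  apply: inj_comp => //; apply: Sf => y; have [x /= /gi <-] := gfs (g y); by exists x.
- by move=> f fb _; exact: bij_inj.
- have [y ny] := infinite_setN0 (big_infinite hOmega nr).
  have ps z : exists x, p x = z by exists (r z).
  by move=> /(_ ps) pi; apply: ny; exists (p y) => //; apply: pi; rewrite pr.
exists t; split=> //.
  by apply: contrapT => nts; apply: nSt => /nts.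
by move=> ti; apply: nSt.
Qed.

Lemma injective_in_T : exists t, [/\ T t, injective t & exists y, ~ range t y].
Proof.
pose S := [set f : Omega -> Omega | injective f -> forall y, exists x, f x = y].
have [r [p [pr nr]]] := big_retraction.
have [|||t Tt nSt] := @maximal_not_sub S r.
- move=> f g Sf Sg gfi y; have fi : injective f.
    by move=> a b e; apply: gfi => /=; rewrite e.
  have fs := Sf fi; have [z <-] : exists z, g z = y.
    apply: Sg => a b e; have [a' ea] := fs a; have [b' eb] := fs b.
    by rewrite -ea -eb; congr f; apply: gfi => /=; rewrite ea eb.
  by have [x <-] := fs z; exists x.
- by move=> f [k _ fk] _ y; exists (k y).
- have [y ny] := infinite_setN0 (big_infinite hOmega nr).
  by move=> /(_ (can_inj pr) y)[x e]; apply: ny; exists x.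
exists t; split=> //.
  by apply: contrapT => nti; apply: nSt => /nti.
apply: contrapT => no; apply: nSt => _ y; apply: contrapT => nx; apply: no; exists y.
by move=> [x _ e]; apply: nx; exists x.
Qed.

Section Cardinal.
Variable L : set Omega.
Hypothesis (iL : infinite_set L).

(** The maps with collapse smaller than [L] or defect at least [L] form a proper
    semigroup containing all permutations. Dually for [defective_in_T]. *)
Lemma collapsing_in_T : exists t, [/\ T t, L #<= collapse setT t & defect t #< L].
Proof.
pose S := [set f : Omega -> Omega | (collapse setT f #< L) \/ L #<= defect f].
have [r [p [pr nr]]] := big_retraction.
have [|||t Tt nSt] := @maximal_not_sub S p.
- move=> f g [cf|df] [cg|dg]; try by right; exact: card_le_trans (defect_comp_ge _ _).
    by left; exact: collapse_comp_lt.
  have [|fgL] := card_le_or_lt L (defect (g \o f)); first by right.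
  by have /(card_le_not_lt df) := defect_comp_cancel iL cg fgL.
- move=> f fb; left; rewrite collapse_bijective //.
  exact: card_lt_infinite (finite_set0 _) iL.
- have pL : L #<= collapse setT p.
    apply: card_le_trans (card_leT L) (card_le_trans nr _); apply: collapse_ge => x.
    by exists (r (p x)); [exists (p x)|rewrite pr].
  have dp : defect p = set0 by apply/seteqP; split=> // y; apply; exists (r y).
  rewrite /S /= dp; case=> [/(card_le_not_lt pL)//|/card_le0P L0].
  by apply: iL; rewrite L0; exact: finite_set0.
exists t; split=> //.
  by have [//|h] := card_le_or_lt L (collapse setT t); case: nSt; left.
by have [h|//] := card_le_or_lt L (defect t); case: nSt; right.
Qed.

Lemma defective_in_T : exists t, [/\ T t, collapse setT t #< L & L #<= defect t].
Proof.
pose S := [set f : Omega -> Omega | L #<= collapse setT f \/ (defect f #< L)].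
have [r [p [pr nr]]] := big_retraction.
have [|||t Tt nSt] := @maximal_not_sub S r.
- move=> f g [cf|df] [cg|dg]; try by left; exact: card_le_trans (collapse_comp_ge _ _).
    have [|fgL] := card_le_or_lt L (collapse setT (g \o f)); first by left.
    by have /(card_le_not_lt cg) := collapse_comp_cancel iL df fgL.
  by right; exact: defect_comp_lt.
- move=> f fb; right; rewrite defect_bijective //.
  exact: card_lt_infinite (finite_set0 _) iL.
- have cr : collapse setT r = set0.
    apply: contrapT => /eqP/set0P/collapse_neq0; apply => x y _ _; exact: (can_inj pr).
  have dL : L #<= defect r by exact: card_le_trans (card_leT L) nr.
  rewrite /S /= cr; case=> [/card_le0P L0|/(card_le_not_lt dL)//].
  by apply: iL; rewrite L0; exact: finite_set0.
exists t; split=> //.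
  by have [h|//] := card_le_or_lt L (collapse setT t); case: nSt; left.
by have [//|h] := card_le_or_lt L (defect t); case: nSt; right.
Qed.
End Cardinal.
End OmittedPermutation.

(** * Passing from large null sets to all null sets *)

Section Classification.
Variables (Omega : Type) (F : set_system Omega) (K : set Omega).
Hypotheses (hOmega : infinite_set [set: Omega]) (hF : UltraFilter F)
  (hnp : forall x : Omega, F <> principal_filter x) (hK : least_card_member F K).
Variable T : set (Omega -> Omega).
Hypotheses (hT : maximal_subsemigroup T) (hS : stabiliser F `<=` T)
  (hSym : ~ (Sym Omega `<=` T)).
Implicit Types (e f g h s t u : Omega -> Omega) (A B D E L R S X Y : set Omega).

Lemma T_subsemigroup : subsemigroup T.
Proof. by case: hT. Qed.

Lemma T_not_all : ~ forall f, T f.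
Proof. by move=> all; apply: hSym => f _. Qed.

Lemma T_id : T id.
Proof. by apply: hS; split=> [|A]; [exists id|rewrite image_id]. Qed.

Lemma T_iter t k : T t -> T (iter k t).
Proof.
by move=> Tt; elim: k => [|k IH]; [exact: T_id|exact: (T_subsemigroup IH Tt)].
Qed.

(** The left ideal of maps with null range and, in [constants_above], the right
    ideal dual to it, both cut off below the cardinal of [L]: the cut-off ideals
    shrink as [L] grows, and the least [L] for which [T] contains them is of
    interest. *)
Definition null_full_above L := forall Y, ~ F Y -> L #<= ~` Y -> full T Y.
Definition constants_above L :=
  forall E, F E -> L #<= E -> forall f, constant_on E f -> T f.

(** The maps [j] with null range and full-sized defect form a left ideal, so [T]
    and the products [t \o j] form a semigroup; it is larger than [T], hence
    contains an omitted permutation as a product [t \o j], and [t] maps the range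
    of [j] bijectively onto [Omega]. *)
Lemma null_surjection : ~ null_full_above [set: Omega] ->
  exists t A, [/\ T t, ~ F A, big (~` A), injective_on A t &
    forall y, exists2 x, A x & t x = y].
Proof.
move=> nN.
pose J (j : Omega -> Omega) := ~ F (range j) /\ big (~` range j).
pose S := T `|` [set f | exists t j, [/\ T t, J j & f = t \o j]].
have Jl f j : J j -> J (j \o f).
  have sub : range (j \o f) `<=` range j by move=> _ [x _ <-]; exists (f x).
  move=> [nj bj]; split; first exact: null_sub nj.
  by apply: card_le_trans bj _; apply: subset_card_le; exact: subsetC.
have hSS : subsemigroup S.
  move=> f g [Tf|[t [j [Tt Jj ->]]]] [Tg|[t' [j' [Tt' Jj' ->]]]].
  - by left; exact: T_subsemigroup.
  - by right; exists t', (j' \o f); split=> //; exact: Jl.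
  - by right; exists (g \o t), j; split=> //; exact: T_subsemigroup.
  - by right; exists t', (j' \o (t \o j)); split=> //; exact: Jl.
have [Y [nY bY [f [fY nTf]]]] : exists Y, [/\ ~ F Y, big (~` Y) &
    exists f, (forall x, Y (f x)) /\ ~ T f].
  apply: contrapT => no; apply: nN => Y nY bY f fY.
  by apply: contrapT => nTf; apply: no; exists Y; split=> //; exists f.
have fsub : range f `<=` Y by move=> _ [x _ <-].
have Sf : S f.
  right; exists id, f; split=> //; first exact: T_id.
  split; first exact: null_sub nY.
  by apply: card_le_trans bY _; apply: subset_card_le; exact: subsetC.
have [s sb nTs] := Sym_outside hSym.
have [//|[t [j [Tt [nj bj] se]]]] := maximal_escape hT hSS (@subsetUl _ _ _) Sf nTf s.
exists t, (range j); split=> //.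
  by move=> _ _ [x _ <-] [y _ <-] e; congr j; apply: (bij_inj sb); rewrite se.
case: sb => r _ rs y; exists (j (r y)); first by exists (r y).
by rewrite -[RHS]rs se.
Qed.

(** Dual of [null_surjection], with the right ideal of maps [j] constant on a
    full-sized member [E] of [F]. When an omitted permutation is [j \o t], the
    range of [t] meets [E] in at most one point. *)
Lemma null_injection : ~ constants_above [set: Omega] ->
  exists t, [/\ T t, injective t, ~ F (range t) & big (~` range t)].
Proof.
move=> nC.
pose J (j : Omega -> Omega) := exists E, [/\ F E, big E & constant_on E j].
pose S := T `|` [set f | exists t j, [/\ T t, J j & f = j \o t]].
have Jr f j : J j -> J (f \o j).
  by move=> [E [FE bE jE]]; exists E; split=> // x y Ex Ey /=; congr f; exact: jE.
have hSS : subsemigroup S.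
  move=> f g [Tf|[t [j [Tt Jj ->]]]] [Tg|[t' [j' [Tt' Jj' ->]]]].
  - by left; exact: T_subsemigroup.
  - by right; exists (t' \o f), j'; split=> //; exact: T_subsemigroup.
  - by right; exists t, (g \o j); split=> //; exact: Jr.
  - by right; exists t, ((j' \o t') \o j); split=> //; exact: Jr.
have [E [FE bE [f [fE nTf]]]] : exists E, [/\ F E, big E &
    exists f, constant_on E f /\ ~ T f].
  apply: contrapT => no; apply: nC => E FE bE f fE.
  by apply: contrapT => nTf; apply: no; exists E; split=> //; exists f.
have Sf : S f by right; exists id, f; split=> //; [exact: T_id|exists E].
have [s sb nTs] := Sym_outside hSym.
have [//|[t [j [Tt [E' [FE' bE' jE']] se]]]] :=
  maximal_escape hT hSS (@subsetUl _ _ _) Sf nTf s.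
have one : finite_set (range t `&` E').
  have [[_ [[z _ <-] Ez]]|n0] := pselect ((range t `&` E') !=set0); last first.
    suff -> : range t `&` E' = set0 by exact: finite_set0.
    by apply/seteqP; split=> // x tx; apply: n0; exists x.
  apply: sub_finite_set (finite_set1 (t z)) => _ [[y _ <-] Ey] /=.
  by congr t; apply: (bij_inj sb); rewrite se; exact: jE'.
exists t; split=> //.
- by move=> x y e; apply: (bij_inj sb); rewrite se /= e.
- by move=> Ft; exact: (F_infinite hF hnp hK (filterI Ft FE') one).
- have [//|lt] := card_le_or_lt [set: Omega] (~` range t); exfalso.
  apply: (card_le_not_lt bE').
  apply: (@sub_card_lt _ _ _ (~` range t `|` (range t `&` E'))).
    by move=> x Ex; have [tx|] := pselect (range t x); [right|left].
  by apply: card_ltU => //; exact: card_lt_infinite.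
Qed.

(** Otherwise [T] contains an injection [r] of [Omega] onto a null set and a map
    [t] sending a null set [A] bijectively onto [Omega], both sets having
    full-sized complements. An element [h] of the stabiliser can match the range
    of [r] with [A] in any way, and [t \o (h \o r)] can be any permutation. *)
Lemma null_full_or_constants :
  null_full_above [set: Omega] \/ constants_above [set: Omega].
Proof.
have [|nN] := pselect (null_full_above [set: Omega]); first by left.
right; apply: contrapT => nC; apply: hSym => s sb.
have [t [A [Tt nA bA ti ts]]] := null_surjection nN.
have [r [Tr ri nr br]] := null_injection nC.
have [x0 _] := Omega_point hOmega.
have /choice[a aP] : forall y, exists x, A x /\ t x = y.
  by move=> y; have [x] := ts y; exists x.
have [x y _ _ /ri->//|p [pr _]] := @factor_on _ _ _ setT r (a \o s) x0.
have pb : bij_on (range r) A p.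
  split.
  - by move=> _ [x _ <-]; rewrite pr //=; case: (aP (s x)).
  - move=> _ _ [x _ <-] [y _ <-]; rewrite !pr //= => e; congr r; apply: (bij_inj sb).
    by have [_ <-] := aP (s x); have [_ <-] := aP (s y); rewrite e.
  - move=> z Az; case: sb => k _ sk; exists (r (k (t z))); first by exists (k (t z)).
    rewrite pr //= sk; have [Aa e] := aP (t z); exact: ti.
have [h hh hp] := stab_extend hOmega hF hnp hK nr nA pb (big_eq br bA).
have -> : s = t \o (h \o r).
  by apply/funext => x /=; rewrite hp // pr //=; have [_ ->] := aP (s x).
by apply: (T_subsemigroup (T_subsemigroup Tr (hS hh)) Tt).
Qed.

(** Shrink the complement of [Y'] to a member of [F] of the size of the complement
    of [Y] and use the stabiliser; the strict bound makes both null sets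
    full-sized. *)
Lemma null_full_shift Y Y' : full T Y -> ~ F Y -> (~` Y #< [set: Omega]) ->
  ~ F Y' -> ~` Y #<= ~` Y' -> full T Y'.
Proof.
move=> fY nY ltY nY' YY'.
have [E [EY' FE EY]] :=
  F_sub_card hOmega hF hnp hK (ultra_null hF nY') (ultra_null hF nY) YY'.
have nE : ~ F (~` E) by exact: ultra_nullC.
have bY : big Y by rewrite -[Y]setCK; exact: compl_big.
have bE : big (~` E).
  by apply: compl_big => //; apply: card_le_lt_trans ltY; have /card_eqPle[] := EY.
have [|h hh [hY _]] := stab_move hOmega hF hnp hK nY nE (big_eq bY bE).
  by rewrite setCK card_eq_sym.
apply: full_sub (full_image T_subsemigroup (hS hh) fY); rewrite hY.
by move=> x Y'x /EY'.
Qed.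

Lemma constants_shift E E' : (forall f, constant_on E f -> T f) ->
  F E -> (E #< [set: Omega]) -> F E' -> E #<= E' -> forall f, constant_on E' f -> T f.
Proof.
move=> cE FE ltE FE' EE' f fE'.
have [E1 [E1E' FE1 EE1]] := F_sub_card hOmega hF hnp hK FE' FE EE'.
have bE : big (~` E) by exact: compl_big.
have bE1 : big (~` E1).
  by apply: compl_big => //; apply: card_le_lt_trans ltE; have /card_eqPle[] := EE1.
have [|h hh [_ hE]] := stab_move hOmega hF hnp hK
    (ultra_nullC hF FE1) (ultra_nullC hF FE) (big_eq bE1 bE).
  by rewrite !setCK.
rewrite !setCK in hE; have [[k hk kh] _] := hh.
have -> : f = (f \o k) \o h by apply/funext => x /=; rewrite hk.
apply: (T_subsemigroup (hS hh)); apply: cE => x y.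
rewrite -hE => -[x' Ex' <-] [y' Ey' <-] /=.
by rewrite !hk; apply: fE'; exact: E1E'.
Qed.

(** Let [L] be the least cardinal, not below that of [K], for which the large null
    sets are full. If it exceeded the cardinal of [K], take [t] in [T] with
    collapse at least [L] and defect smaller than [L]. A transversal of [t], after
    removing few points to make it and its image null, is full because its
    complement is large; its image is then a full null set with complement smaller
    than [L], contradicting minimality. *)
Lemma null_full : null_full_above [set: Omega] -> forall Y, ~ F Y -> full T Y.
Proof.
move=> NO.
pose P := {L : set Omega | K #<= L /\ null_full_above L}.
have PO : P by exists setT; split=> //; exact: card_leT.
have [[L [KL NL]] Lmin] := @card_min P (fun=> Omega) (fun i => sval i) (inhabits PO).
have [LK|K_lt] := card_le_or_lt L K.
  move=> Y nY; apply: (NL Y) => //.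
  exact: card_le_trans LK (K_le hK (ultra_null hF nY)).
exfalso.
have iL : infinite_set L by apply: infinite_card_le KL (K_infinite hF hnp hK).
have [t [Tt ct dt]] := collapsing_in_T hOmega hT hSym iL.
have [X [cX Xi Xt]] := collapseT t; rewrite cX in ct.
(* Avoiding [K] makes [Y] null, and avoiding the preimage of [K] makes [t @` Y]
   null. *)
pose Y := [set x | [/\ X x, ~ K x & ~ K (t x)]].
have nK : ~ F (~` K) by apply: ultra_nullC; case: hK.
have nY : ~ F Y by apply: null_sub nK => x [].
have ntY : ~ F (t @` Y) by apply: null_sub nK => _ [x [_ _ nKt] <-].
have fY : full T Y.
  by apply: (NL Y) => //; apply: card_le_trans ct _; apply: subset_card_le => x nXx [].
have ltY : ~` (t @` Y) #< L.
  apply: (@sub_card_lt _ _ _ (defect t `|` (t @` K `|` K))).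
    move=> y; have [[x _ <-] ny|] := pselect (range t y); last by left.
    have [x' Xx' e] := Xt x; right.
    have [Ktx|nKtx] := pselect (K (t x)); first by right.
    left; exists x' => //; apply: contrapT => nKx'; apply: ny.
    by exists x' => //; split=> //; rewrite e.
  by do !apply: card_ltU => //; exact: card_image_lt.
have PtY : K #<= ~` (t @` Y) /\ null_full_above (~` (t @` Y)).
  split; first by apply: (K_le hK); exact: ultra_null.
  move=> Z nZ; apply: null_full_shift => //; first exact: (full_image T_subsemigroup).
  exact: card_lt_le_trans ltY (card_leT L).
exact: (card_le_not_lt (Lmin (exist _ _ PtY))).
Qed.

(** Dual of [null_full], with [t] of defect at least [L] and collapse smaller than
    [L]. The set [E] is saturated for [t], small, in [F], and [t] is injective
    outside it with null image. A map constant on [E] is then [t] followed by a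
    map constant on the complement of that image, which is at least as large as
    [L]. *)
Lemma constants_in_T : constants_above [set: Omega] ->
  forall E, F E -> forall f, constant_on E f -> T f.
Proof.
move=> CO.
pose P := {L : set Omega | K #<= L /\ constants_above L}.
have PO : P by exists setT; split=> //; exact: card_leT.
have [[L [KL CL]] Lmin] := @card_min P (fun=> Omega) (fun i => sval i) (inhabits PO).
have [LK|K_lt] := card_le_or_lt L K.
  by move=> E FE; apply: (CL E) => //; apply: card_le_trans LK (K_le hK FE).
exfalso; have [x0 _] := Omega_point hOmega.
have iL : infinite_set L by apply: infinite_card_le KL (K_infinite hF hnp hK).
have [t [Tt ct dt]] := defective_in_T hOmega hT hSym iL.
have [X [cX Xi Xt]] := collapseT t; rewrite cX in ct.
(* The three parts of [B] make [t] injective outside [E], put [E] in [F], and put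
   [E0] in [F]. *)
pose B := t @` (~` X) `|` (t @` K `|` K).
pose E := t @^-1` B.
have BL : B #< L by do !apply: card_ltU => //; exact: card_image_lt.
have FE : F E by case: (hK) => FK _; apply: filterS FK => x Kx; right; left; exists x.
have EL : E #< L.
  apply: (@sub_card_lt _ _ _ (~` X `|` (X `&` t @^-1` B))).
    by move=> x Ex; have [Xx|] := pselect (X x); [right|left].
  by apply: card_ltU => //; apply: card_le_lt_trans BL; exact: card_le_inj_preimage.
pose E0 := ~` (t @` (~` E)).
have BE0 : B `<=` E0 by move=> y By [x nEx e]; apply: nEx; rewrite /E /= e.
have FE0 : F E0.
  by case: (hK) => FK _; apply: filterS FK => x Kx; apply: BE0; right; right.
have LE0 : L #<= E0.
  apply: card_le_trans dt _; apply: subset_card_le => y ny [x _ e].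
  by apply: ny; exists x.
have XE x : ~ E x -> X x.
  by move=> nEx; apply: contrapT => nXx; apply: nEx; left; exists x.
have PE : K #<= E /\ constants_above E.
  split; first exact: (K_le hK).
  move=> E' FE' EE'; apply: (constants_shift (E := E)) => //; last first.
    exact: card_lt_le_trans EL (card_leT L).
  move=> f fE; have [c0 fc0] : exists c, forall x, E x -> f x = c.
    by have [z Ez] := filter_ex FE; exists (f z) => x Ex; exact: fE.
  have [x y /XE Xx /XE Xy /(Xi _ _ Xx Xy)->//|u [uf uc]] :=
    @factor_on _ _ _ (~` E) t f c0.
  have -> : f = u \o t.
    apply/funext => x /=; have [Ex|nEx] := pselect (E x); last by rewrite uf.
    by rewrite fc0 // uc // ; exact: BE0.
  by apply: (T_subsemigroup Tt); apply: (CL _ FE0 LE0) => x y Ex Ey; rewrite !uc.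
exact: (card_le_not_lt (Lmin (exist _ _ PE))).
Qed.

End Classification.

(** * Identifying the maximal subsemigroup *)

Section Identification.
Variables (Omega : Type) (F : set_system Omega) (K : set Omega).
Hypotheses (hOmega : infinite_set [set: Omega]) (hF : UltraFilter F)
  (hnp : forall x : Omega, F <> principal_filter x) (hK : least_card_member F K).
Variable T : set (Omega -> Omega).
Hypotheses (hT : maximal_subsemigroup T) (hS : stabiliser F `<=` T)
  (hSym : ~ (Sym Omega `<=` T)).
Implicit Types (e f g h s t u : Omega -> Omega) (A B D E L R S X Y : set Omega).

Lemma le_succ_card_sub R : le_succ_card R [set: Omega].
Proof.
have [J [S [OS Smin]]] := succ_card_exists [set: Omega].
by exists J, S; split=> //; apply: card_le_trans (card_leT R) (card_ltW OS).
Qed.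

(** A null transversal [X] of [f] is full already. If [X] is in [F], its
    complement contains a copy of the complement of [D0], so an element of the
    stabiliser maps [D0] onto a set containing [X]. Hence [X] is full, and so is
    its image under [f]. *)
Lemma full_range_of_collapse D0 f :
  (forall Y, ~ F Y -> full T Y) -> F D0 -> big D0 -> full T D0 ->
  T f -> F (range f) -> big (range f) -> ~` D0 #<= collapse setT f ->
  full T (range f).
Proof.
move=> nf FD bD fD Tf Ff bf cf.
have [X [cX Xi Xf]] := collapseT f; rewrite cX in cf.
suff fX : full T X.
  apply: full_sub (full_image (T_subsemigroup hT) Tf fX) => _ [x _ <-].
  by have [y Xy <-] := Xf x; exists y.
have [FX|/nf//] := pselect (F X).
have bX := big_image_transversal bf Xf.
have [x0 _] := Omega_point hOmega.
have [p [pX pi]] := card_le_mapE x0 cf.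
have pD := card_image_on pi; set R := p @` (~` D0) in pD.
have RX : X `<=` ~` R by move=> x Xx [y Dy e]; apply: (pX _ Dy); rewrite e.
have nR : ~ F R by apply: null_sub (ultra_nullC hF FX) => x Rx /RX; apply.
have bR : big (~` R) by apply: card_le_trans bX _; exact: subset_card_le.
have [||h hh [_ hD]] := stab_move hOmega hF hnp hK (ultra_nullC hF FD) nR.
- by rewrite card_eq_sym.
- by apply: big_eq => //; rewrite setCK.
rewrite setCK in hD.
apply: full_sub RX _; rewrite -hD.
exact: (full_image (T_subsemigroup hT) (hS hh) fD).
Qed.

(** Let [D] be a full member of [F] of full size whose complement is minimal. By
    [full_range_of_collapse] no element of [T] with range in [F] and full-sized
    has collapse at least [~` D] and defect smaller than [~` D]; by [full_in_F] an
    element of [T] that sends a null set onto a member of [F] cannot have defect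
    smaller than [~` D] when [~` D] exceeds [K]. *)
Lemma maximal_is_U1 : (forall Y, ~ F Y -> full T Y) ->
  exists (I : Type) (M : set I),
    [/\ infinite_set M, K #< M, le_succ_card M [set: Omega] & T = U1 F M].
Proof.
move=> nf; have iK := K_infinite hF hnp hK.
have eqU1 I (M : set I) : infinite_set M -> (K #< M) -> T `<=` U1 F M -> T = U1 F M.
  move=> iM KM; apply: (maximal_eq hT).
    exact: U1_subsemigroup.
  exact: (Sym_notU1 hOmega hF hnp hK iM).
pose P := {D | [/\ F D, big D & full T D]}.
have [[D0 D0P]|noP] := pselect (exists D, [/\ F D, big D & full T D]); last first.
  have [J [S sS]] := succ_card_exists [set: Omega]; have [OS Smin] := sS.
  have iS : infinite_set S by exact: infinite_card_le (card_ltW OS) hOmega.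
  have KS : K #< S by exact: card_le_lt_trans (card_leT K) OS.
  exists J, S; split=> //; first by exists J, S; split=> //; exact: card_lexx.
  apply: eqU1 => // f Tf; apply: contrapT => /notU1P[_ Ff bf [cf|[A nA FA]]].
    by apply: (card_le_not_lt cf); exact: card_le_lt_trans (card_leT _) OS.
  have [D [FD bD fD _]] := full_in_F hOmega hF hK (T_subsemigroup hT) nf Tf bf nA FA.
  by apply: noP; exists D.
have [[D [FD bD fD]] Dmin] :=
  @card_min P (fun=> Omega) (fun i => ~` (sval i)) (inhabits (exist _ _ D0P)).
rewrite /= in Dmin.
have min f : T f -> F (range f) -> big (range f) -> ~` D #<= collapse setT f ->
    ~` D #<= defect f.
  move=> Tf Ff bf cf.
  have fP : [/\ F (range f), big (range f) & full T (range f)].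
    by split=> //; exact: full_range_of_collapse cf.
  exact: (Dmin (exist _ _ fP)).
have [RK|KR] := card_le_or_lt (~` D) K; last first.
  have iR : infinite_set (~` D) by exact: infinite_card_le (card_ltW KR) iK.
  exists Omega, (~` D); split=> //; first exact: le_succ_card_sub.
  apply: eqU1 => // f Tf; apply: contrapT => /notU1P[df Ff bf [cf|[A nA FA]]].
    by apply: card_le_not_lt (min _ Tf Ff bf cf) df.
  have [D' [FD' bD' fD' sub]] :=
    full_in_F hOmega hF hK (T_subsemigroup hT) nf Tf bf nA FA.
  have D'P : [/\ F D', big D' & full T D'] by [].
  apply: card_le_not_lt (Dmin (exist _ _ D'P)) _.
  by apply: sub_card_lt sub _; apply: card_ltU => //; exact: card_image_lt.
exfalso.
have contra f : T f -> ~` D #<= collapse setT f -> (defect f #< ~` D) -> False.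
  move=> Tf cf df; have dK : defect f #< K by exact: card_lt_le_trans RK.
  have Ff : F (range f).
    by rewrite -[range f]setCK; apply: (ultra_null hF); exact: (lt_K_null hK).
  have bf : big (range f).
    rewrite -[range f]setCK; apply: compl_big => //.
    exact: card_lt_le_trans dK (card_leT K).
  exact: card_le_not_lt (min _ Tf Ff bf cf) df.
(* An infinite complement is excluded by [collapsing_in_T], the empty one because
   [T] would be everything, and one of [k > 0] points by the [k]-th iterate of a
   surjective [t] that is not injective. *)
have [[k Rk]|iR] := pselect (finite_set (~` D)); last first.
  by have [t [Tt ct dt]] := collapsing_in_T hOmega hT hSym iR; exact: contra ct dt.
have [R0|/eqP/set0P[z Rz]] := pselect (~` D = set0).
  apply: (T_not_all hSym) => f; apply: fD => x; apply: contrapT => nDx.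
  by have : (~` D) (f x) by []; rewrite R0.
have [t [Tt ts nti]] := surjective_in_T hOmega hT hSym.
have /choice[r tr] := ts.
have ri : injective r by exact: can_inj tr.
have [x nx] : exists x, ~ range r x.
  apply: contrapT => no; apply: nti => a b e.
  have rt c : r (t c) = c.
    have [d _ <-] : range r c by apply: contrapT => nc; apply: no; exists c.
    by rewrite tr.
  by rewrite -(rt a) -(rt b) e.
have iterK j : cancel (iter j r) (iter j t).
  by elim: j => // j IH y; rewrite [iter j.+1 t _]iterSr [iter j.+1 r y]iterS tr IH.
apply: (contra (iter k t)); first exact: (T_iter hT hS).
  have /card_eqPle[Rk' _] := Rk; apply: card_le_trans Rk' _.
  apply: card_le_trans (iter_defect k ri nx) _; apply: collapse_ge => y.
  by exists (iter k r (iter k t y)); [exists (iter k t y)|rewrite iterK].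
have -> : defect (iter k t) = set0.
  by apply/seteqP; split=> // y; apply; exists (iter k r y); rewrite ?iterK.
apply/card_ltP => /card_le0P R0; have : (~` D) z by [].
by rewrite R0.
Qed.

(** If the range of [f] is null, every map factoring through [f] factors through
    it by a map constant on a member of [F], so [f] itself will do. Otherwise an
    element of the stabiliser puts the range of [f] inside a transversal [X] of
    [e] belonging to [F]: there is room because the defect of [f] is at least the
    collapse of [e]. Then [e \o (h \o f)] has the same fibres as [f]. *)
Lemma cofull_of_defect e D f :
  (forall E, F E -> forall f, constant_on E f -> T f) ->
  cofull T e -> big (range e) -> F D -> injective_on D e ->
  T f -> big (range f) -> collapse setT e #<= defect f ->
  exists e', [/\ cofull T e', big (range e'), collapse setT e' #<= collapse setT f &
    forall A, injective_on A f -> injective_on A e'].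
Proof.
move=> cst ce be FD Di Tf bf df; have [x0 _] := Omega_point hOmega.
have [Ff|nFf] := pselect (F (range f)); last first.
  exists f; split=> //.
  move=> u.
  have [x y _ _ /(congr1 u)//|u' [u's u'c]] :=
    @factor_on _ _ _ setT f (u \o f) x0.
  have -> : u \o f = u' \o f by apply/funext => x; rewrite /= u's.
  apply: (T_subsemigroup hT Tf); apply: (cst _ (ultra_null hF nFf)) => x y nx ny.
  by rewrite !u'c.
have [X [DX Xi Xe]] := transversalT Di.
have FX : F X by exact: filterS FD.
have bX := big_image_transversal be Xe.
have [p [pf pi]] := card_le_mapE x0 (card_le_trans (collapse_ge Xe) df).
have pR := card_image_on pi; set R := p @` (~` X) in pR.
have fR : range f `<=` ~` R by move=> x fx [y Xy ex]; apply: (pf _ Xy); rewrite ex.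
have nR : ~ F R by apply: null_sub (ultra_nullC hF Ff) => x Rx /fR; apply.
have bR : big (~` R) by apply: card_le_trans bf _; exact: subset_card_le.
have [|h hh [_ hX]] := stab_move hOmega hF hnp hK nR (ultra_nullC hF FX) pR.
  by apply: big_eq => //; rewrite setCK.
rewrite setCK in hX.
have hfX x : X (h (f x)) by rewrite -hX; exists (f x) => //; apply: fR; exists x.
have hi : injective h by have [hb _] := hh; exact: bij_inj.
have inj A : injective_on A f -> injective_on A (e \o (h \o f)).
  by move=> Ai x y Ax Ay /= /(Xi _ _ (hfX x) (hfX y))/hi; exact: Ai.
exists (e \o (h \o f)); split=> //.
- apply: (cofull_comp (T_subsemigroup hT)) => //.
  by apply: (T_subsemigroup hT Tf); exact: hS.
- have [Z [_ Zi Zf]] := collapseT f.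
  apply: card_le_trans (big_image_transversal bf Zf) _.
  by apply: (card_le_map (f := e \o (h \o f))); [move=> x _; exists x|exact: inj].
- by have [Z [-> Zi Zf]] := collapseT f; apply: collapse_le; exact: inj.
Qed.

(** Dual of [maximal_is_U1]; the least collapse of a map [e] with [Q e] replaces
    the least complement. *)
Lemma maximal_is_U2 : (forall E, F E -> forall f, constant_on E f -> T f) ->
  exists (I : Type) (M : set I),
    [/\ infinite_set M, K #< M, le_succ_card M [set: Omega] & T = U2 F M].
Proof.
move=> cst; have iK := K_infinite hF hnp hK.
have eqU2 I (M : set I) : infinite_set M -> (K #< M) -> T `<=` U2 F M -> T = U2 F M.
  move=> iM KM; apply: (maximal_eq hT).
    exact: U2_subsemigroup.
  exact: (Sym_notU2 hOmega hF hnp hK iM).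
pose Q e := [/\ cofull T e, big (range e) & exists2 D, F D & injective_on D e].
pose P := {e | Q e}.
have [[e0 e0P]|noP] := pselect (exists e, Q e); last first.
  have [J [S sS]] := succ_card_exists [set: Omega]; have [OS Smin] := sS.
  have iS : infinite_set S by exact: infinite_card_le (card_ltW OS) hOmega.
  have KS : K #< S by exact: card_le_lt_trans (card_leT K) OS.
  exists J, S; split=> //; first by exists J, S; split=> //; exact: card_lexx.
  apply: eqU2 => // f Tf; apply: contrapT => /notU2P[_ [D FD Di] bf [df|[A FA nA]]].
    by apply: (card_le_not_lt df); exact: card_le_lt_trans (card_leT _) OS.
  have DAi : injective_on (D `&` A) f by move=> x y [Dx _] [Dy _]; exact: Di.
  have nDA : ~ F (f @` (D `&` A)) by apply: null_sub nA; apply: image_subset => x [].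
  have [e [ce ei be _]] := cofull_collapsing hOmega hF hK (T_subsemigroup hT)
    cst Tf bf DAi (filterI FD FA) nDA.
  by apply: noP; exists e; split=> //; exists (D `&` A) => //; exact: filterI.
have [[e [ce be [D FD Di]]] emin] :=
  @card_min P (fun=> Omega) (fun i => collapse setT (sval i))
    (inhabits (exist _ _ e0P)).
rewrite /= in emin; set R := collapse setT e in emin.
have min f : T f -> big (range f) -> (exists2 A, F A & injective_on A f) ->
    R #<= defect f -> R #<= collapse setT f.
  move=> Tf bf [A FA Ai] df.
  have [e' [ce' be' ce'f e'i]] := cofull_of_defect cst ce be FD Di Tf bf df.
  have eP : Q e' by split=> //; exists A => //; exact: e'i.
  exact: card_le_trans (emin (exist _ _ eP)) ce'f.
have [RK|KR] := card_le_or_lt R K; last first.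
  have iR : infinite_set R by exact: infinite_card_le (card_ltW KR) iK.
  exists Omega, R; split=> //; first exact: le_succ_card_sub.
  apply: eqU2 => // f Tf; apply: contrapT => /notU2P[cf [D' FD' D'i] bf [df|[A FA nA]]].
    by apply: card_le_not_lt (min _ Tf bf _ df) cf; exists D'.
  have DAi : injective_on (D' `&` A) f by move=> x y [Dx _] [Dy _]; exact: D'i.
  have nDA : ~ F (f @` (D' `&` A)) by apply: null_sub nA; apply: image_subset => x [].
  have [e' [ce' ei' be' eM]] :=
    cofull_collapsing hOmega hF hK (T_subsemigroup hT) cst Tf bf DAi
      (filterI FD' FA) nDA.
  have eP : Q e' by split=> //; exists (D' `&` A) => //; exact: filterI.
  by apply: card_le_not_lt (emin (exist _ _ eP)) _; exact: eM.
exfalso.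
have contra f : T f -> R #<= defect f -> (collapse setT f #< R) -> False.
  move=> Tf df cf; have cK : collapse setT f #< K by exact: card_lt_le_trans RK.
  have [X [cX Xi Xf]] := collapseT f.
  have FX : F X by rewrite -[X]setCK -cX; apply: (ultra_null hF); exact: (lt_K_null hK).
  have bX : big X.
    rewrite -[X]setCK -cX; apply: compl_big => //.
    exact: card_lt_le_trans cK (card_leT K).
  apply: card_le_not_lt (min _ Tf _ _ df) cf; last by exists X.
  by apply: card_le_trans bX _; apply: (card_le_map (f := f)) => // x _; exists x.
(* As before, with [defective_in_T] for infinite [R] and, for [R] of [k > 0]
   points, the [k]-th iterate of an injection that is not surjective. *)
have [[k Rk]|iR] := pselect (finite_set R); last first.
  by have [t [Tt ct dt]] := defective_in_T hOmega hT hSym iR; exact: contra dt ct.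
have [R0|/eqP/set0P[z Rz]] := pselect (R = set0).
  apply: (T_not_all hSym); apply: (cofull_injective hOmega ce) => x y exy.
  apply: contrapT => nxy; have : collapse setT e !=set0.
    by apply/collapse_neq0 => ei; apply: nxy; exact: ei.
  by rewrite -/R R0 => -[].
have [t [Tt ti [x nx]]] := injective_in_T hOmega hT hSym.
apply: (contra (iter k t)); first exact: (T_iter hT hS).
  by have /card_eqPle[Rk' _] := Rk; apply: card_le_trans Rk' (iter_defect k ti nx).
have -> : collapse setT (iter k t) = set0.
  apply: contrapT => /eqP/set0P/collapse_neq0; apply => a b _ _.
  exact: iter_injective.
by apply/card_ltP => /card_le0P R0; rewrite R0 in Rz.
Qed.

End Identification.

Unset Implicit Arguments.
Set Strict Implicit.
Set Printing Implicit Defensive.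

Theorem theorem3 (Omega : Type) (hOmega : infinite_set [set: Omega])
  (F : set_system Omega) (hF : UltraFilter F)
  (hnp : forall x : Omega, F <> principal_filter x)
  (K : set Omega) (hK : least_card_member F K)
  (T : set (Omega -> Omega)) :
  [/\ maximal_subsemigroup T, stabiliser F `<=` T & ~ (Sym Omega `<=` T)] <->
  exists (I : Type) (M : set I),
    [/\ infinite_set M, K #< M, le_succ_card M [set: Omega] &
        T = U1 F M \/ T = U2 F M].
Proof.
split=> [[hT hS hSym]|[I [M [iM KM _ [->|->]]]]].
- have [nf|cst] := null_full_or_constants hOmega hF hnp hK hT hS hSym.
    have [I [M [iM KM sM TE]]] := maximal_is_U1 hOmega hF hnp hK hT hS hSym
      (null_full hOmega hF hnp hK hT hS hSym nf).
    by exists I, M; split=> //; left.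
  have [I [M [iM KM sM TE]]] := maximal_is_U2 hOmega hF hnp hK hT hS hSym
    (constants_in_T hOmega hF hnp hK hT hS hSym cst).
  by exists I, M; split=> //; right.
- split; [exact: (U1_maximal hOmega hF hnp hK)|exact: stabiliser_U1|].
  exact: (Sym_notU1 hOmega hF hnp hK).
- split; [exact: (U2_maximal hOmega hF hnp hK)|exact: stabiliser_U2|].
  exact: (Sym_notU2 hOmega hF hnp hK).
Qed.
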